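(* A graph is $\{P_5,\overline{P_5}\}$-free if and only if it is obtained from pentagons and split graphs by repeated substitutions, split graph unifications, and split graph unifications in the complement (that is, if and only if it belongs to the smallest isomorphism-closed class of graphs that contains all pentagons and all split graphs and is closed under these three operations).
   Context: All graphs are finite and simple. $V_G$ is the vertex-set of $G$, $\overline{G}$ is the complement of $G$, and $G[X]$ is the subgraph of $G$ induced by $X\subseteq V_G$; $G\smallsetminus v=G[V_G\smallsetminus\{v\}]$. $P_5$ is the path on five vertices, and a pentagon is the cycle $C_5$ on five vertices. $G$ is $\mathcal{H}$-free if no induced subgraph of $G$ is isomorphic to a member of $\mathcal{H}$. A split graph is a graph whose vertex-set can be partitioned into a (possibly empty) clique and a (possibly empty) stable set. A vertex $v\notin X$ is complete (anti-complete) to $X$ if it is adjacent (non-adjacent) to every vertex of $X$; disjoint sets $A,B$ are complete (anti-complete) to each other if every vertex of $A$ is complete (anti-complete) to $B$. Substitution: given graphs $G_1,G_2$ with disjoint vertex-sets and $u\in V_{G_2}$, $G$ is obtained by substituting $G_1$ for $u$ in $G_2$ if $V_G=V_{G_1}\cup(V_{G_2}\smallsetminus\{u\})$, $G[V_{G_1}]=G_1$, $G[V_{G_2}\smallsetminus\{u\}]=G_2\smallsetminus u$, and each $v\in V_{G_2}\smallsetminus\{u\}$ is complete to $V_{G_1}$ in $G$ if $v$ is adjacent to $u$ in $G_2$, and anti-complete to $V_{G_1}$ in $G$ otherwise. Split graph unification: let $A,B,C,L,T$ be pairwise disjoint sets with $A$ and $C$ non-empty, and let $a,c$ be distinct vertices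 not in $A\cup B\cup C\cup L\cup T$. Let $G_1$ be a graph with vertex-set $A\cup L\cup T\cup\{c\}$ in which $L$ is a (possibly empty) clique, $T$ is a (possibly empty) stable set, $A$ is anti-complete to $T$, and $c$ is complete to $L$ and anti-complete to $A\cup T$. Let $G_2$ be a graph with vertex-set $B\cup C\cup L\cup T\cup\{a\}$ in which $G_2[L\cup T]=G_1[L\cup T]$, $T$ is anti-complete to $C$, $L$ is complete to $B\cup C$, and $a$ is complete to $B$ and anti-complete to $C\cup L\cup T$. Then $(G_1,G_2)$ is called a composable pair, and its split graph unification is the graph $G$ with vertex-set $A\cup B\cup C\cup L\cup T$ such that $G[A\cup L\cup T]=G_1\smallsetminus c$, $G[B\cup C\cup L\cup T]=G_2\smallsetminus a$, and $A$ is complete to $B$ and anti-complete to $C$ in $G$. A graph $G$ is obtained from $G_1,G_2$ by split graph unification in the complement if $\overline{G}$ is the split graph unification of the composable pair $(G_1,G_2)$. *)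

(* Defs.v *)
From HB Require Import structures.
From mathcomp Require Import all_boot.

Set Implicit Arguments.
Unset Strict Implicit.
Unset Printing Implicit Defensive.

(* The operations below form unions of vertex-sets and compare induced          *)
(* subgraphs of different graphs, so the vertex-set of a graph is a subset of   *)
(* an ambient finite type U, not always all of U.  Edges are two-element sets;  *)
(* hence equality in [graph U] is equality of vertex-sets and edge-sets.        *)

Definition wf_graph (U : finType) (VE : {set U} * {set {set U}}) : bool :=
  [forall e in VE.2, (e \subset VE.1) && (#|e| == 2)].

Record graph (U : finType) : Type := Graph {
  graph_val : {set U} * {set {set U}};
  graph_wf : wf_graph graph_val
}.

HB.instance Definition _ (U : finType) := [isSub for @graph_val U].
HB.instance Definition _ (U : finType) := [Equality of graph U by <:].

Definition vertices (U : finType) (G : graph U) : {set U} := (graph_val G).1.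
Definition edges (U : finType) (G : graph U) : {set {set U}} := (graph_val G).2.

Definition adj (U : finType) (G : graph U) : rel U :=
  fun x y => [set x; y] \in edges G.

Lemma mk_graph_wf (U : finType) (V : {set U}) (E : {set {set U}}) :
  wf_graph (V, [set e in E | (e \subset V) && (#|e| == 2)]).
Proof. by apply/forall_inP => e; rewrite inE => /andP[]. Qed.

(* Members of E that are not two-element subsets of V are discarded. *)
Definition mk_graph (U : finType) (V : {set U}) (E : {set {set U}}) : graph U :=
  Graph (mk_graph_wf V E).

Definition compl_graph (U : finType) (G : graph U) : graph U :=
  mk_graph (vertices G) (~: edges G).

Definition induced (U : finType) (G : graph U) (X : {set U}) : graph U :=
  mk_graph (vertices G :&: X) (edges G).

Definition del_vertex (U : finType) (G : graph U) (v : U) : graph U :=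
  induced G (vertices G :\ v).

Definition isomorphic (U W : finType) (G : graph U) (H : graph W) : Prop :=
  exists f : {x | x \in vertices G} -> {y | y \in vertices H},
    bijective f /\ forall x y, adj H (val (f x)) (val (f y)) = adj G (val x) (val y).

Definition path_graph (n : nat) : graph 'I_n :=
  mk_graph setT [set [set i; j] | i in 'I_n, j in 'I_n & j == i.+1 :> nat].

(* This is the cycle on n vertices only for n >= 3. *)
Definition cycle_graph (n : nat) : graph 'I_n :=
  mk_graph setT [set [set i; j] | i in 'I_n, j in 'I_n & j == i.+1 %% n :> nat].

Definition P5 : graph 'I_5 := path_graph 5.
Definition C5 : graph 'I_5 := cycle_graph 5.

Definition pentagon (U : finType) (G : graph U) : Prop := isomorphic G C5.

Definition is_free (W : finType) (Hs : seq (graph W)) (U : finType) (G : graph U) :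
    Prop :=
  forall (H : graph W) (X : {set U}),
    H \in Hs -> X \subset vertices G -> ~ isomorphic (induced G X) H.

Section Adjacency.
Variables (U : finType) (G : graph U).

Definition clique (K : {set U}) : bool :=
  (K \subset vertices G) && [forall x in K, forall y in K, (x != y) ==> adj G x y].

Definition stable (S : {set U}) : bool :=
  (S \subset vertices G) && [forall x in S, forall y in S, ~~ adj G x y].

Definition vcomplete (v : U) (X : {set U}) : bool :=
  (v \notin X) && [forall x in X, adj G v x].

Definition vanticomplete (v : U) (X : {set U}) : bool :=
  (v \notin X) && [forall x in X, ~~ adj G v x].

Definition complete (X Y : {set U}) : bool :=
  [disjoint X & Y] && [forall x in X, vcomplete x Y].

Definition anticomplete (X Y : {set U}) : bool :=
  [disjoint X & Y] && [forall x in X, vanticomplete x Y].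

Definition split_graph : Prop :=
  exists K S : {set U},
    [/\ vertices G = K :|: S, [disjoint K & S], clique K & stable S].

End Adjacency.

Definition substitution (U : finType) (G1 G2 : graph U) (u : U) (G : graph U) :
    Prop :=
  let V1 := vertices G1 in
  let V2 := vertices G2 :\ u in
  [/\ [disjoint vertices G1 & vertices G2],
      u \in vertices G2,
      vertices G = V1 :|: V2,
      induced G V1 = G1 /\ induced G V2 = del_vertex G2 u
    & forall v, v \in V2 ->
        if adj G2 v u then vcomplete G v V1 else vanticomplete G v V1].

Record composable_pair (U : finType) (A B C L T : {set U}) (a c : U)
    (G1 G2 : graph U) : Prop := {
  cp_disjoint :
    pairwise (fun X Y : {set U} => [disjoint X & Y]) [:: A; B; C; L; T];
  cp_A_neq0 : A != set0;
  cp_C_neq0 : C != set0;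
  cp_a_neq_c : a != c;
  cp_a_new : a \notin A :|: B :|: C :|: L :|: T;
  cp_c_new : c \notin A :|: B :|: C :|: L :|: T;
  cp_V1 : vertices G1 = A :|: L :|: T :|: [set c];
  cp_L_clique : clique G1 L;
  cp_T_stable : stable G1 T;
  cp_A_T : anticomplete G1 A T;
  cp_c_L : vcomplete G1 c L;
  cp_c_AT : vanticomplete G1 c (A :|: T);
  cp_V2 : vertices G2 = B :|: C :|: L :|: T :|: [set a];
  cp_LT : induced G2 (L :|: T) = induced G1 (L :|: T);
  cp_T_C : anticomplete G2 T C;
  cp_L_BC : complete G2 L (B :|: C);
  cp_a_B : vcomplete G2 a B;
  cp_a_CLT : vanticomplete G2 a (C :|: L :|: T)
}.

Definition split_graph_unification (U : finType) (G1 G2 G : graph U) : Prop :=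
  exists (A B C L T : {set U}) (a c : U),
    composable_pair A B C L T a c G1 G2 /\
    [/\ vertices G = A :|: B :|: C :|: L :|: T,
        induced G (A :|: L :|: T) = del_vertex G1 c,
        induced G (B :|: C :|: L :|: T) = del_vertex G2 a,
        complete G A B
      & anticomplete G A C].

(* The ambient type may change along isomorphisms, so the vertices needed for  *)
(* an operation are always available in some larger ambient type.              *)
Inductive obtained : forall U : finType, graph U -> Prop :=
| obtained_iso (U W : finType) (G : graph U) (H : graph W) :
    obtained G -> isomorphic G H -> obtained H
| obtained_pentagon (U : finType) (G : graph U) :
    pentagon G -> obtained G
| obtained_split (U : finType) (G : graph U) :
    split_graph G -> obtained G
| obtained_substitution (U : finType) (G1 G2 G : graph U) (u : U) :
    obtained G1 -> obtained G2 -> substitution G1 G2 u G -> obtained G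
| obtained_unification (U : finType) (G1 G2 G : graph U) :
    obtained G1 -> obtained G2 -> split_graph_unification G1 G2 G -> obtained G
| obtained_counification (U : finType) (G1 G2 G : graph U) :
    obtained G1 -> obtained G2 ->
    split_graph_unification G1 G2 (compl_graph G) -> obtained G.

(* Main.v *)
Require Import Defs.
From mathcomp Require Import all_boot.

(* That the operations preserve freeness is checked on the types (A, B, C, L, T)
   that five vertices inducing P5 or its complement may have: either the five
   vertices survive in one of the two pieces, after replacing one of them by a
   or c, or the types are inconsistent.

   Conversely, let G be free, without homogeneous set (else it is obtained by a
   substitution) and not a pentagon.  Then G has no induced C5, since a vertex
   sees none, all, or a twin's share of a pentagon.  A {2K2, C4, C5}-free graph
   is split, so up to complementation G contains 2K2.  Take X maximal such that
   G[X] has two nontrivial components; let A be one of them, T the set of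
   isolated vertices of G[X], C the rest of X, and S the complement of X.  By
   maximality each vertex of S has a neighbour in every nontrivial component,
   and it is mixed on at most one side.  If S is a clique, then G is a
   unification with L the set of vertices of S mixed on A.  Otherwise let H be
   an anticomponent of S with at least two vertices, chosen with the largest
   possible set of vertices of T complete to it.  Nonadjacent vertices of S have
   the same neighbours in A and C, and the complement of G is a unification in
   which H plays the role of A and the vertices of T mixed on H form L.

   In a unification no vertex a of A anticomplete to L is needed for G2 to be
   free: a five-vertex obstruction containing a and two vertices of L does not
   exist, and each single vertex of L has a nonneighbour in A. *)

Set Implicit Arguments.
Unset Strict Implicit.
Unset Printing Implicit Defensive.

(** * Graphs and induced subgraphs *)

Lemma eq_set2 (U : finType) (x y a b : U) :
  ([set x; y] == [set a; b]) = ((x == a) && (y == b)) || ((x == b) && (y == a)).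
Proof.
apply/eqP/idP => [E|/orP[]/andP[/eqP-> /eqP->] //]; last by rewrite setUC.
have hx : x \in [set a; b] by rewrite -E set21.
have hy : y \in [set a; b] by rewrite -E set22.
have ha : a \in [set x; y] by rewrite E set21.
have hb : b \in [set x; y] by rewrite E set22.
move: hx hy ha hb; rewrite !in_set2.
rewrite (eq_sym a x) (eq_sym a y) (eq_sym b x) (eq_sym b y).
by case: (x == a); case: (x == b); case: (y == a); case: (y == b).
Qed.

Section Basics.
Variable U : finType.
Implicit Types (G H : graph U) (V X : {set U}) (r : rel U).

Lemma adj_sym G : symmetric (adj G).
Proof. by move=> x y; rewrite /adj setUC. Qed.

Lemma edges_wf G (e : {set U}) :
  e \in edges G -> (e \subset vertices G) && (#|e| == 2).
Proof. by move: e; apply/forall_inP; exact: graph_wf. Qed.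

Lemma adj_irr G : irreflexive (adj G).
Proof.
by move=> x; apply/negP => /edges_wf/andP[_]; rewrite setUid cards1.
Qed.

Lemma adj_vertices G x y : adj G x y -> x \in vertices G.
Proof. by move=> /edges_wf/andP[/subsetP + _]; apply; rewrite set21. Qed.

Lemma adj_verticesr G x y : adj G x y -> y \in vertices G.
Proof. by rewrite adj_sym; apply: adj_vertices. Qed.

Lemma adj_mk V (E : {set {set U}}) x y :
  adj (mk_graph V E) x y = [&& x \in V, y \in V, x != y & [set x; y] \in E].
Proof.
rewrite /adj /edges /= inE subUset !sub1set cards2.
by case: (x \in V); case: (y \in V); case: (x == y); case: (_ \in E).
Qed.

Lemma adj_induced G X x y :
  adj (induced G X) x y = [&& x \in X, y \in X & adj G x y].
Proof.
rewrite adj_mk !inE -/(adj G x y).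
case E: (adj G x y); last by rewrite !andbF.
rewrite (adj_vertices E) (adj_verticesr E) /= andbT.
by have [F|_] := eqVneq x y; rewrite ?andbT // F adj_irr in E.
Qed.

Lemma adj_compl G x y :
  adj (compl_graph G) x y =
    [&& x \in vertices G, y \in vertices G, x != y & ~~ adj G x y].
Proof. by rewrite adj_mk !inE. Qed.

Lemma graph_ext G H :
  vertices G = vertices H -> adj G =2 adj H -> G = H.
Proof.
move=> eV eA; apply: val_inj.
rewrite [val G]surjective_pairing [val H]surjective_pairing.
congr (_, _); first exact: eV.
apply/setP => e; apply/idP/idP => he.
  have /andP[_ /cards2P[x [y [_ E]]]] := @edges_wf G e he.
  by rewrite E in he *; move: (eA x y) he; rewrite /adj /edges => ->.
have /andP[_ /cards2P[x [y [_ E]]]] := @edges_wf H e he.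
by rewrite E in he *; move: (eA x y) he; rewrite /adj /edges => ->.
Qed.

(** Meant for symmetric [r]: an unordered pair becomes an edge as soon as [r] holds in one of the
    two orders. Loops and pairs leaving [V] are discarded by [mk_graph]. *)
Definition gr V r : graph U :=
  mk_graph V [set [set p.1; p.2] | p in [pred p : U * U | r p.1 p.2]].

Lemma adj_gr V r x y : symmetric r ->
  adj (gr V r) x y = [&& x \in V, y \in V, x != y & r x y].
Proof.
move=> rs; rewrite adj_mk; congr [&& _, _, _ & _].
apply/imsetP/idP => [[[a b] /= rab /eqP]|rxy]; last by exists (x, y).
rewrite eq_set2 => /orP[]/andP[/eqP-> /eqP->] //.
by rewrite rs.
Qed.

Lemma induced_gr V r X : symmetric r -> X \subset V -> induced (gr V r) X = gr X r.
Proof.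
move=> rs XV; apply: graph_ext; first by apply/setIidPr.
move=> x y; rewrite adj_induced !adj_gr //.
case xX: (x \in X) => //; case yX: (y \in X) => //.
by rewrite !(subsetP XV).
Qed.

Lemma del_vertex_gr V r x : symmetric r -> del_vertex (gr V r) x = gr (V :\ x) r.
Proof. by move=> rs; rewrite /del_vertex induced_gr // subsetDl. Qed.

Lemma compl_graphK G : compl_graph (compl_graph G) = G.
Proof.
apply: graph_ext => // x y; rewrite !adj_compl /=.
case xV: (x \in vertices G); last first.
  by symmetry; apply: contraFF xV; apply: adj_vertices.
case yV: (y \in vertices G); last first.
  by symmetry; apply: contraFF yV; apply: adj_verticesr.
by have [->|_] := eqVneq x y; rewrite /= ?adj_irr ?negbK.
Qed.

End Basics.

(** * Isomorphisms and the five-vertex patterns *)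

Section Isomorphism.
Variables (U W : finType).

Lemma isomorphic_sym (G : graph U) (H : graph W) : isomorphic G H -> isomorphic H G.
Proof.
case=> f [[g fK gK] fA]; exists g; split; first by exists f.
by move=> x y; rewrite -fA !gK.
Qed.

(** Allows an isomorphism to be given by a map of ambient types instead of a bijection of subtypes;
    bijectivity comes from injectivity and equal cardinalities. *)
Lemma isomorphicI (G : graph U) (H : graph W) (h : U -> W) :
  {in vertices G &, injective h} -> h @: vertices G = vertices H ->
  {in vertices G &, forall x y, adj H (h x) (h y) = adj G x y} ->
  isomorphic G H.
Proof.
move=> hI hV hA.
have hin (x : {x | x \in vertices G}) : h (val x) \in vertices H.
  by rewrite -hV imset_f ?(valP x).
pose f (x : {x | x \in vertices G}) : {y | y \in vertices H} := Sub (h (val x)) (hin x).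
exists f; split; last by move=> x y; rewrite hA ?(valP x) ?(valP y).
apply: inj_card_bij.
  move=> x y /(congr1 val) /= E; apply: val_inj.
  by apply: hI => //; [exact: (valP x) | exact: (valP y)].
by rewrite !card_sig -hV card_in_imset.
Qed.

End Isomorphism.

(** The patterns are relations on [nat], read only below 5, so that statements about them can be
    settled by computation. *)
Definition path_rel : rel nat := fun i j => (j == i.+1) || (i == j.+1).
Definition house_rel : rel nat := fun i j => (i != j) && ~~ path_rel i j.
Definition pent_rel : rel nat := fun i j => (j == i.+1 %% 5) || (i == j.+1 %% 5).

Definition induces (M : rel nat) (T : Type) (e : rel T) : Prop :=
  exists v : nat -> T, forall i j, i < 5 -> j < 5 -> e (v i) (v j) = M i j.

(** Having no isolated vertex forces every [v] as in [induces] to land in the vertex-set of the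
    graph, and having no two vertices with the same neighbours forces [v] to be injective. Hence
    [induces] need not ask for either. *)
Definition twin_free (M : rel nat) : bool :=
  all (fun i => has (M i) (iota 0 5) &&
    all (fun j => (i == j) || has (fun k => M i k != M j k) (iota 0 5)) (iota 0 5))
    (iota 0 5).

Section Induces.
Variables (U : finType) (G : graph U) (M : rel nat).
Hypothesis Mtf : twin_free M.

Lemma all_iota5P (P : pred nat) : reflect (forall i, i < 5 -> P i) (all P (iota 0 5)).
Proof.
by apply: (iffP allP) => h i; move: (h i); rewrite mem_iota.
Qed.

Lemma induces_in (v : nat -> U) :
  (forall i j, i < 5 -> j < 5 -> adj G (v i) (v j) = M i j) ->
  forall i, i < 5 -> v i \in vertices G.
Proof.
move=> hv i i5; move/all_iota5P: Mtf => /(_ i i5)/andP[/hasP[j]].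
by rewrite mem_iota => j5 Mij _; apply: (@adj_vertices _ _ _ (v j)); rewrite hv.
Qed.

Lemma induces_inj (v : nat -> U) :
  (forall i j, i < 5 -> j < 5 -> adj G (v i) (v j) = M i j) ->
  forall i j, i < 5 -> j < 5 -> v i = v j -> i = j.
Proof.
move=> hv i j i5 j5 E; move/all_iota5P: Mtf => /(_ i i5)/andP[_ /all_iota5P/(_ j j5)].
case/orP => [/eqP //|/hasP[k]]; rewrite mem_iota => k5.
by rewrite -!hv // E eqxx.
Qed.

Lemma inducesP (H : graph 'I_5) :
  vertices H = setT -> (forall i j, adj H i j = M i j) ->
  (exists2 X : {set U}, X \subset vertices G & isomorphic (induced G X) H) <-> induces M (adj G).
Proof.
move=> HT HA; split=> [[X XV /isomorphic_sym[g [_ gA]]]|[v hv]].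
  have iH (i : 'I_5) : i \in vertices H by rewrite HT in_setT.
  pose w i : {i | i \in vertices H} := exist _ i (iH i).
  pose v n := val (g (w (inord n))).
  exists v => i j i5 j5.
  have := gA (w (inord i)) (w (inord j)).
  rewrite /= HA !inordK // => <-.
  rewrite adj_induced.
  have gX k : val (g (w k)) \in X.
    by have := valP (g (w k)); rewrite /= inE => /andP[].
  by rewrite !gX.
exists [set v (nat_of_ord i) | i : 'I_5].
  by apply/subsetP => _ /imsetP[i _ ->]; apply: induces_in.
apply: isomorphic_sym; apply: (@isomorphicI _ _ _ _ (fun i : 'I_5 => v i)).
- by move=> i j _ _ /(induces_inj hv) E; apply: val_inj; apply: E.
- rewrite HT; apply/setP => x; rewrite /= inE; apply/idP/andP => [|[_]] /imsetP[i _ ->].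
    by split; [apply: induces_in | apply: imset_f].
  by apply: imset_f; rewrite in_setT.
move=> i j _ _; rewrite adj_induced !imset_f //= HA.
exact: hv.
Qed.

End Induces.

Definition free (T : Type) (e : rel T) : Prop :=
  ~ induces path_rel e /\ ~ induces house_rel e.

Lemma adj_path_graph n i j : adj (path_graph n) i j = path_rel i j.
Proof.
rewrite adj_mk !in_setT /=; apply/andP/idP => [[nij /imset2P[a b _]]|].
  rewrite inE /= => /eqP E /eqP; rewrite eq_set2 /path_rel.
  by case/orP => /andP[/eqP-> /eqP->]; rewrite E eqxx ?orbT.
case/orP => /eqP E; split.
- by apply/eqP => F; move/eqP: E; rewrite F eqn_leq ltnn andbF.
- by apply/imset2P; exists i j; rewrite ?inE ?E //=.
- by apply/eqP => F; move/eqP: E; rewrite F eqn_leq ltnn andbF.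
- by apply/imset2P; exists j i; rewrite ?inE ?E //= setUC.
Qed.

Lemma adj_house i j : adj (compl_graph P5) i j = house_rel i j.
Proof. by rewrite adj_compl !in_setT adj_path_graph. Qed.

Lemma adj_C5 i j : adj C5 i j = pent_rel i j.
Proof.
rewrite adj_mk !in_setT /=; apply/andP/idP => [[nij /imset2P[a b _]]|].
  rewrite inE => /eqP E /eqP; rewrite eq_set2 /pent_rel.
  by case/orP => /andP[/eqP-> /eqP->]; rewrite E eqxx ?orbT.
have H : all (fun i => all (fun j => pent_rel i j ==> (i != j)) (iota 0 5)) (iota 0 5) by [].
move=> Pij; split.
  move/all_iota5P: H => /(_ i (ltn_ord i))/all_iota5P/(_ j (ltn_ord j)).
  by rewrite Pij.
case/orP: Pij => E.
- by apply/imset2P; exists i j; rewrite ?inE.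
- by apply/imset2P; exists j i; rewrite ?inE // setUC.
Qed.

Lemma is_freeP (U : finType) (G : graph U) :
  is_free [:: P5; compl_graph P5] G <-> free (adj G).
Proof.
have tp : twin_free path_rel by [].
have th : twin_free house_rel by [].
have pP := inducesP G tp (erefl : vertices P5 = setT) (@adj_path_graph 5).
have hP := inducesP G th (erefl : vertices (compl_graph P5) = setT) adj_house.
split=> [fr|[f1 f2] H X].
  split=> [/pP|/hP] [X XV iso]; apply: (fr _ X) iso => //; rewrite !inE eqxx //.
  by rewrite orbT.
rewrite !inE => /orP[]/eqP-> XV iso; [apply: f1; apply/pP | apply: f2; apply/hP];
  by exists X.
Qed.

Lemma pentagonP (U : finType) (G : graph U) (v : nat -> U) :
  (forall i j, i < 5 -> j < 5 -> adj G (v i) (v j) = pent_rel i j) ->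
  vertices G = [set v (nat_of_ord i) | i : 'I_5] -> pentagon G.
Proof.
move=> hv GV; apply: isomorphic_sym.
have tc : twin_free pent_rel by [].
apply: (@isomorphicI _ _ _ _ (fun i : 'I_5 => v i)).
- by move=> i j _ _ /(induces_inj tc hv) E; apply: val_inj; apply: E.
- by rewrite GV; apply/setP => x; apply/imsetP/imsetP => -[i _ ->]; exists i; rewrite ?in_setT.
by move=> i j _ _; rewrite adj_C5; apply: hv.
Qed.

(** * Closure of freeness under the operations *)

(* Under [vm_compute], [find] stops at the first failure whereas [all] does not,
   because both arguments of [&&] are evaluated. *)
Definition all_lt (n : nat) (P : pred nat) : bool := find (predC P) (iota 0 n) == n.

Lemma all_ltP n (P : pred nat) : reflect (forall i, i < n -> P i) (all_lt n P).
Proof.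
have -> : all_lt n P = all P (iota 0 n).
  have := has_find (predC P) (iota 0 n); have := find_size (predC P) (iota 0 n).
  by rewrite size_iota has_predC => le hE; rewrite /all_lt eqn_leq le leqNgt -hE negbK.
by apply: (iffP allP) => h i; move: (h i); rewrite mem_iota.
Qed.

Lemma all_ltPn n (P : pred nat) : ~~ all_lt n P -> exists2 i, i < n & ~~ P i.
Proof.
move=> h; have [/hasP[i]|/hasPn nh] := boolP (has (predC P) (iota 0 n)).
  by rewrite mem_iota => ? ?; exists i.
case/negP: h; apply/all_ltP => i i_n; rewrite -[P i]negbK; apply: nh.
by rewrite mem_iota.
Qed.

Definition all5 (n : nat) (P : pred (nat -> nat)) : bool :=
  all_lt n (fun a => all_lt n (fun b => all_lt n (fun c => all_lt n (fun d =>
  all_lt n (fun f => P (nth 0 [:: a; b; c; d; f])))))).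

(** The enumeration only meets functions of the form [nth 0 s]. Without functional extensionality
    the conclusion is therefore about a [t'] that agrees with [t] below 5. *)
Lemma all5P n (P : pred (nat -> nat)) (t : nat -> nat) :
  all5 n P -> (forall i, i < 5 -> t i < n) ->
  exists2 t' : nat -> nat, P t' & forall i, i < 5 -> t' i = t i.
Proof.
move=> H tn; exists (nth 0 [:: t 0; t 1; t 2; t 3; t 4]); last by case=> [|[|[|[|[|]]]]].
move/all_ltP: H => /(_ _ (tn 0 isT))/all_ltP/(_ _ (tn 1 isT))/all_ltP.
by move=> /(_ _ (tn 2 isT))/all_ltP/(_ _ (tn 3 isT))/all_ltP/(_ _ (tn 4 isT)).
Qed.

Definition all2_5 (P : rel nat) : bool := all_lt 5 (fun i => all_lt 5 (P i)).

Lemma all2_5P (P : rel nat) :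
  reflect (forall i j, i < 5 -> j < 5 -> P i j) (all2_5 P).
Proof.
apply: (iffP (all_ltP _ _)) => [h i j i5 j5|h i i5]; last by apply/all_ltP => j; apply: h.
by move/all_ltP: (h i i5); apply.
Qed.

(* A table prescribes the adjacency of two distinct vertices from their types,
   [None] meaning that it is arbitrary. *)
Definition consistent (K : nat -> nat -> option bool) (M : rel nat) (t : nat -> nat) :=
  all2_5 (fun i j => (i == j) || (if K (t i) (t j) is Some b then M i j == b else true)).

Definition at_most_one (k : nat) (t : nat -> nat) : bool :=
  all2_5 (fun i j => (t i == k) && (t j == k) ==> (i == j)).

Lemma at_most_oneP k t :
  at_most_one k t -> forall i j, i < 5 -> j < 5 -> t i = k -> t j = k -> i = j.
Proof.
by move=> /all2_5P h i j i5 j5 ti tj; have := h i j i5 j5; rewrite ti tj eqxx => /eqP.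
Qed.

Lemma free_iso (U W : finType) (G : graph U) (H : graph W) :
  isomorphic G H -> free (adj G) -> free (adj H).
Proof.
move=> /isomorphic_sym[g [_ gA]].
have K (M : rel nat) : twin_free M -> induces M (adj H) -> induces M (adj G).
  move=> tf [v hv]; have vH := induces_in tf hv.
  pose v0 : {y | y \in vertices H} := exist _ (v 0) (vH 0 isT).
  (* [v0] is a default for arguments outside [vertices H]; it is never reached for indices below
     5. *)
  exists (fun i => val (g (insubd v0 (v i)))) => i j i5 j5.
  by rewrite gA !insubdK -?topredE /= ?vH // hv.
by case=> f1 f2; split=> [/K|/K] => /(_ isT).
Qed.

Lemma free_C5 : free (adj C5).
Proof.
have K (M : rel nat) : all5 5 (fun t => ~~ all2_5 (fun i j => pent_rel (t i) (t j) == M i j)) ->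
    ~ induces M (adj C5).
  move=> ck [v hv].
  have [i _|t tP te] := @all5P _ _ (fun i => v i : nat) ck; first exact: ltn_ord.
  case/negP: tP; apply/all2_5P => i j i5 j5.
  by rewrite !te // -hv // adj_C5.
by split; apply: K; vm_compute.
Qed.

Lemma free_pentagon (U : finType) (G : graph U) : pentagon G -> free (adj G).
Proof. by move/isomorphic_sym => /free_iso; apply; apply: free_C5. Qed.

Lemma free_split (U : finType) (G : graph U) : split_graph G -> free (adj G).
Proof.
case=> K [S [GV _ /andP[_ /forall_inP cK] /andP[_ /forall_inP cS]]].
(* Type 0 is the clique and type 1 the stable set; nothing is prescribed between them. *)
pose tb i j := if i != j then None else Some (i == 0).
have Q (M : rel nat) : twin_free M -> all5 2 (fun t => ~~ consistent tb M t) ->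
    ~ induces M (adj G).
  move=> tf ck [v hv].
  have [i _|t tP te] := @all5P _ _ (fun i => (v i \notin K : nat)) ck; first by case: (_ \notin K).
  case/negP: tP; apply/all2_5P => i j i5 j5.
  have [//|nij] := eqVneq i j; rewrite !te // /tb -hv //=.
  have nv : v i != v j.
    by apply: contra nij => /eqP /(induces_inj tf hv)->.
  have vi := induces_in tf hv i5; have vj := induces_in tf hv j5.
  move: vi vj; rewrite GV !inE.
  case: (boolP (v i \in K)) => iK; case: (boolP (v j \in K)) => jK //= iS jS.
    by move/forall_inP: (cK _ iK) => /(_ _ jK); rewrite nv => /= ->.
  by move/forall_inP: (cS _ iS) => /(_ _ jS) /negbTE->.
by split; apply: Q; vm_compute.
Qed.

(** The vertices of a pattern that lie in [G1] look alike from the rest of the pattern. Both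
    patterns are prime, so either all five lie in [G1], or at most one does and [u] can replace it
    in [G2]. *)
Lemma free_substitution (U : finType) (G1 G2 G : graph U) (u : U) :
  substitution G1 G2 u G -> free (adj G1) -> free (adj G2) -> free (adj G).
Proof.
move=> [_ uV2 GV [E1 E2] cmp] f1 f2.
(* Type 1 means membership in [G1]. *)
pose hom (M : rel nat) (t : nat -> nat) := all_lt 5 (fun i => (t i == 1) ||
  all2_5 (fun j k => (t j == 1) && (t k == 1) ==> (M i j == M i k))).
have Q (M : rel nat) : twin_free M ->
    all5 2 (fun t => hom M t ==> all_lt 5 (fun i => t i == 1) || at_most_one 1 t) ->
    induces M (adj G) -> induces M (adj G1) \/ induces M (adj G2).
  move=> tf ck [v hv]; have vG := induces_in tf hv.
  have [i _|t tP te] := @all5P _ _ (fun i => (v i \in vertices G1 : nat)) ck; first by case: (_ \in _).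
  have t1 i : i < 5 -> (t i == 1) = (v i \in vertices G1) by move=> i5; rewrite te // eqb1.
  have v2 i : i < 5 -> v i \notin vertices G1 -> v i \in vertices G2 :\ u.
    by move=> /vG; rewrite GV in_setU => /orP[->|].
  have A12 i j : i < 5 -> j < 5 -> v i \notin vertices G1 -> v j \in vertices G1 ->
      M i j = adj G2 (v i) u.
    move=> i5 j5 vi vj; rewrite -hv //; have := cmp _ (v2 _ i5 vi).
    case: (adj G2 _ _) => /andP[_ /forall_inP/(_ _ vj)] //.
    by move/negbTE.
  have hm : hom M t.
    apply/all_ltP => i i5; rewrite t1 //; case: (boolP (_ \in _)) => //= vi.
    apply/all2_5P => j k j5 k5; rewrite !t1 //; apply/implyP => /andP[vj vk].
    by rewrite (A12 i j) // (A12 i k).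
  move: tP; rewrite hm => /orP[/all_ltP h1|h2]; [left|right].
    exists v => i j i5 j5.
    have vi : v i \in vertices G1 by rewrite -t1 // h1.
    have vj : v j \in vertices G1 by rewrite -t1 // h1.
    by rewrite -E1 adj_induced vi vj hv.
  exists (fun i => if v i \in vertices G1 then u else v i) => i j i5 j5.
  case: ifP => vi; case: ifP => vj.
  - have -> : i = j by apply: (at_most_oneP h2) => //; apply/eqP; rewrite t1.
    by rewrite adj_irr -hv // adj_irr.
  - by rewrite adj_sym -(A12 j i) ?vj // -!hv // adj_sym.
  - by rewrite -(A12 i j) ?vi.
  have := congr1 (fun H => adj H (v i) (v j)) E2.
  by rewrite /del_vertex !adj_induced !v2 ?vi ?vj // hv // => <-.
have cp : all5 2 (fun t => hom path_rel t ==> all_lt 5 (fun i => t i == 1) || at_most_one 1 t).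
  vm_compute; exact (erefl true).
have ch : all5 2 (fun t => hom house_rel t ==> all_lt 5 (fun i => t i == 1) || at_most_one 1 t).
  vm_compute; exact (erefl true).
case: f1 f2 => [f1p f1h] [f2p f2h].
by split=> [/(@Q path_rel isT cp)|/(@Q house_rel isT ch)] [].
Qed.

Section Unification.
Variables (U : finType) (G1 G2 G : graph U).

(** The types 0, 1, 2, 3, 4 stand for A, B, C, L, T in this order. *)
Definition unif_table (i j : nat) : option bool :=
  match i, j with
  | 0, 4 | 4, 0 | 0, 2 | 2, 0 | 4, 2 | 2, 4 | 4, 4 => Some false
  | 0, 1 | 1, 0 | 3, 1 | 1, 3 | 3, 2 | 2, 3 | 3, 3 => Some true
  | _, _ => None
  end.

Lemma free_unification : split_graph_unification G1 G2 G ->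
  free (adj G1) -> free (adj G2) -> free (adj G).
Proof.
case=> A [B [C [L [T [a [c [cp [GV E1 E2 cAB cAC]]]]]]]] f1 f2.
case: cp => dis _ _ _ aN cN _ cL cT cAT ccL ccAT _ _ cTC cLBC caB caCLT.
have adj1 x y : x \in A :|: L :|: T -> y \in A :|: L :|: T -> adj G x y = adj G1 x y.
  move=> hx hy; have := congr1 (fun H => adj H x y) E1.
  rewrite /del_vertex !adj_induced hx hy /= => ->.
  have N z : z \in A :|: L :|: T -> z != c.
    by move=> hz; apply: contraNneq cN => <-; move: hz; rewrite !inE => /orP[/orP[]|] ->; rewrite ?orbT.
  rewrite !inE !N //=; case E: (adj G1 x y); rewrite ?andbF //.
  by rewrite (adj_vertices E) (adj_verticesr E).
have adj2 x y : x \in B :|: C :|: L :|: T -> y \in B :|: C :|: L :|: T -> adj G x y = adj G2 x y.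
  move=> hx hy; have := congr1 (fun H => adj H x y) E2.
  rewrite /del_vertex !adj_induced hx hy /= => ->.
  have N z : z \in B :|: C :|: L :|: T -> z != a.
    by move=> hz; apply: contraNneq aN => <-; move: hz; rewrite !inE => /orP[/orP[/orP[]|]|] ->; rewrite ?orbT.
  rewrite !inE !N //=; case E: (adj G2 x y); rewrite ?andbF //.
  by rewrite (adj_vertices E) (adj_verticesr E).
pose sets := [:: A; B; C; L; T].
pose cls x := find (fun X : {set U} => x \in X) sets.
have cls5 x : x \in vertices G -> cls x < 5 /\ x \in nth set0 sets (cls x).
  move=> xG; have h : has (fun X : {set U} => x \in X) sets.
    by move: xG; rewrite GV !inE /= orbF => /orP[/orP[/orP[/orP[]|]|]|] ->; rewrite ?orbT.
  by split; [rewrite -[5]/(size sets) -has_find | exact: (nth_find set0 h)].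
have compl_ (H : graph U) (X Y : {set U}) : complete H X Y ->
    forall x y, x \in X -> y \in Y -> adj H x y.
  by move=> /andP[_ /forall_inP h] x y /h /andP[_ /forall_inP h'] /h'.
have anti_ (H : graph U) (X Y : {set U}) : anticomplete H X Y ->
    forall x y, x \in X -> y \in Y -> adj H x y = false.
  by move=> /andP[_ /forall_inP h] x y /h /andP[_ /forall_inP h'] /h' /negbTE.
have tbP k l b x y : unif_table k l = Some b -> x \in nth set0 sets k ->
    y \in nth set0 sets l -> x != y -> adj G x y = b.
  have fAT x' y' : x' \in A -> y' \in T -> adj G x' y' = false.
    by move=> hx hy; rewrite adj1 ?inE ?hx ?hy ?orbT //; apply: anti_ cAT _ _ _ _.
  have fTC x' y' : x' \in T -> y' \in C -> adj G x' y' = false.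
    by move=> hx hy; rewrite adj2 ?inE ?hx ?hy ?orbT //; apply: anti_ cTC _ _ _ _.
  have fLB x' y' : x' \in L -> y' \in B -> adj G x' y' = true.
    by move=> hx hy; rewrite adj2 ?inE ?hx ?hy ?orbT //; apply: compl_ cLBC _ _ _ _; rewrite ?inE ?hy.
  have fLC x' y' : x' \in L -> y' \in C -> adj G x' y' = true.
    by move=> hx hy; rewrite adj2 ?inE ?hx ?hy ?orbT //; apply: compl_ cLBC _ _ _ _; rewrite ?inE ?hy ?orbT.
  have fAB : forall x' y', x' \in A -> y' \in B -> adj G x' y' = true := compl_ _ _ _ cAB.
  have fAC := anti_ _ _ _ cAC.
  have fLL x' y' : x' \in L -> y' \in L -> x' != y' -> adj G x' y' = true.
    move=> hx hy n; rewrite adj1 ?inE ?hx ?hy ?orbT //.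
    by case/andP: cL => _ /forall_inP/(_ _ hx)/forall_inP/(_ _ hy)/implyP; apply.
  have fTT x' y' : x' \in T -> y' \in T -> adj G x' y' = false.
    move=> hx hy; rewrite adj1 ?inE ?hx ?hy ?orbT //.
    by case/andP: cT => _ /forall_inP/(_ _ hx)/forall_inP/(_ _ hy)/negbTE.
  by case: k => [|[|[|[|[|k]]]]] //; case: l => [|[|[|[|[|l]]]]] //= [<-] hx hy n; auto;
    rewrite adj_sym; auto.
(* [cA] says that the pattern survives in [G2] with [a] in place of its vertex in A: adjacencies to
   B, C and T agree automatically, those to L must be absent. [cC] says that it survives in [G1]
   with [c] in place of its vertex in C, where only B has to be avoided. *)
pose cA (M : rel nat) (t : nat -> nat) := at_most_one 0 t &&
  all2_5 (fun i j => (t i == 0) && (t j == 3) ==> ~~ M i j).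
pose cC (t : nat -> nat) := at_most_one 2 t && all_lt 5 (fun i => t i != 1).
have Q (M : rel nat) : twin_free M ->
    all5 5 (fun t => consistent unif_table M t ==> cA M t || cC t) ->
    induces M (adj G) -> induces M (adj G1) \/ induces M (adj G2).
  move=> tf ck [v hv]; have vG := induces_in tf hv.
  have [i i5|t tP te] := @all5P _ _ (fun i => cls (v i)) ck; first by case: (cls5 _ (vG i i5)).
  have tS i : i < 5 -> v i \in nth set0 sets (t i) by move=> i5; rewrite te //; case: (cls5 _ (vG i i5)).
  have t5 i : i < 5 -> t i < 5 by move=> i5; rewrite te //; case: (cls5 _ (vG i i5)).
  have Mtb i j b : i < 5 -> j < 5 -> i != j -> unif_table (t i) (t j) = Some b -> M i j = b.
    move=> i5 j5 nij tb; rewrite -hv //; apply: (tbP _ _ _ _ _ tb); rewrite ?tS //.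
    by apply: contra nij => /eqP /(induces_inj tf hv)->.
  have Mi i : i < 5 -> M i i = false by move=> i5; rewrite -hv // adj_irr.
  have Ms i j : i < 5 -> j < 5 -> M i j = M j i by move=> i5 j5; rewrite -!hv // adj_sym.
  have : consistent unif_table M t.
    apply/all2_5P => i j i5 j5; have [//|nij] := eqVneq i j.
    by case E: (unif_table _ _) => [b|] //=; rewrite (Mtb _ _ _ i5 j5 nij E).
  move: tP => /implyP h /h /orP[/andP[h1 /all2_5P h2]|/andP[h1 /all_ltP h2]]; [right|left].
    have nA i : i < 5 -> t i != 0 -> v i \in B :|: C :|: L :|: T.
      by move=> i5; move: (tS i i5) (t5 i i5); case: (t i) => [|[|[|[|[|k]]]]] //=;
        rewrite !inE => ->; rewrite ?orbT.
    have aj i j : i < 5 -> j < 5 -> t i = 0 -> t j != 0 -> adj G2 a (v j) = M i j.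
      move=> i5 j5 ti tj.
      have nij : i != j by apply: contraNneq tj => <-; apply/eqP.
      have [EB|nB] := eqVneq (t j) 1.
        rewrite (@Mtb i j true) //; last by rewrite ti EB.
        by case/andP: caB => _ /forall_inP; apply; have := tS j j5; rewrite EB.
      have -> : M i j = false.
        have [EL|nL] := eqVneq (t j) 3.
          by apply/negbTE; have := h2 i j i5 j5; rewrite ti EL.
        apply: Mtb => //; move: tj nB nL (t5 j j5); rewrite ti.
        by case: (t j) => [|[|[|[|[|k]]]]].
      case/andP: caCLT => _ /forall_inP caCLT; apply/negbTE; apply: caCLT.
      move: (tS j j5) tj nB (t5 j j5).
      by case: (t j) => [|[|[|[|[|k]]]]] //=; rewrite !inE => ->; rewrite ?orbT.
    exists (fun i => if t i == 0 then a else v i) => i j i5 j5.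
    have [ti|ti] := eqVneq (t i) 0; have [tj|tj] := eqVneq (t j) 0.
    - by rewrite (at_most_oneP h1 i5 j5) // adj_irr Mi.
    - by apply: aj.
    - by rewrite adj_sym Ms //; apply: aj.
    by rewrite -adj2 ?nA // hv.
  have nC i : i < 5 -> t i != 2 -> v i \in A :|: L :|: T.
    by move=> i5; move: (tS i i5) (t5 i i5) (h2 i i5); case: (t i) => [|[|[|[|[|k]]]]] //=;
      rewrite !inE => ->; rewrite ?orbT.
  have cj i j : i < 5 -> j < 5 -> t i = 2 -> t j != 2 -> adj G1 c (v j) = M i j.
    move=> i5 j5 ti tj.
    have nij : i != j by apply: contraNneq tj => <-; apply/eqP.
    have [EL|nL] := eqVneq (t j) 3.
      rewrite (@Mtb i j true) //; last by rewrite ti EL.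
      by case/andP: ccL => _ /forall_inP; apply; have := tS j j5; rewrite EL.
    have nB := h2 j j5.
    have -> : M i j = false.
      apply: Mtb => //; move: tj nB nL (t5 j j5); rewrite ti.
      by case: (t j) => [|[|[|[|[|k]]]]].
    case/andP: ccAT => _ /forall_inP ccAT; apply/negbTE; apply: ccAT.
    move: (tS j j5) tj nB nL (t5 j j5).
    by case: (t j) => [|[|[|[|[|k]]]]] //=; rewrite !inE => ->; rewrite ?orbT.
  exists (fun i => if t i == 2 then c else v i) => i j i5 j5.
  have [ti|ti] := eqVneq (t i) 2; have [tj|tj] := eqVneq (t j) 2.
  - by rewrite (at_most_oneP h1 i5 j5) // adj_irr Mi.
  - by apply: cj.
  - by rewrite adj_sym Ms //; apply: cj.
  by rewrite -adj1 ?nC // hv.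
have cp : all5 5 (fun t => consistent unif_table path_rel t ==> cA path_rel t || cC t).
  vm_compute; exact (erefl true).
have ch : all5 5 (fun t => consistent unif_table house_rel t ==> cA house_rel t || cC t).
  vm_compute; exact (erefl true).
case: f1 f2 => [f1p f1h] [f2p f2h].
by split=> [/(@Q path_rel isT cp)|/(@Q house_rel isT ch)] [].
Qed.

End Unification.

(** Complementation exchanges the two patterns. *)
Lemma free_compl (U : finType) (G : graph U) :
  free (adj G) -> free (adj (compl_graph G)).
Proof.
have Q (M M' : rel nat) : twin_free M -> all2_5 (fun i j => M' i j == (i != j) && ~~ M i j) ->
    induces M (adj (compl_graph G)) -> induces M' (adj G).
  move=> tf /all2_5P E [v hv]; exists v => i j i5 j5.
  rewrite (eqP (E i j i5 j5)) -hv // adj_compl.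
  have vG k : k < 5 -> v k \in vertices G by move/(induces_in tf hv).
  rewrite !vG //=; have [->|nij] := eqVneq i j; first by rewrite adj_irr.
  have -> : v i != v j by apply: contra nij => /eqP /(induces_inj tf hv)->.
  by rewrite negbK.
by case=> f1 f2; split=> [/Q|/Q] h; [apply: f2 | apply: f1]; apply: h.
Qed.

Lemma obtained_free (U : finType) (G : graph U) : obtained G -> free (adj G).
Proof.
elim=> {U G}.
- by move=> U W G H _ fG /free_iso; apply.
- by move=> U G; apply: free_pentagon.
- by move=> U G; apply: free_split.
- by move=> U G1 G2 G u _ f1 _ f2 /free_substitution; apply.
- by move=> U G1 G2 G _ f1 _ f2 /free_unification; apply.
- move=> U G1 G2 G _ f1 _ f2 /free_unification/(_ f1 f2)/free_compl.
  by rewrite compl_graphK.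
Qed.

(** * Decomposition into smaller pieces *)

(* The partition underlying a unification into two smaller pieces; the last
   condition stands for the vertex a, which need not have a copy in A. *)
Definition divided (U : finType) (V : {set U}) (e : rel U) : Prop :=
  exists A B C L T : {set U},
  [/\ pairwise (fun X Y : {set U} => [disjoint X & Y]) [:: A; B; C; L; T],
      V = A :|: B :|: C :|: L :|: T, 1 < #|A|, C != set0 & 1 < #|B :|: C| ] /\
  [/\ {in L &, forall x y, x != y -> e x y}, {in T &, forall x y, ~~ e x y},
      {in A & T, forall x y, ~~ e x y}, {in A & B, forall x y, e x y}
    & {in A & C, forall x y, ~~ e x y}] /\
  [/\ {in L & B :|: C, forall x y, e x y}, {in T & C, forall x y, ~~ e x y}
    & {in L, forall x, exists2 a, a \in A & ~~ e x a}].

(* [inr true] and [inr false] are the two additional vertices a and c. *)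
Definition extend (U : finType) (e : rel U) (Na Nc : {set U}) : rel (U + bool) :=
  fun x y => match x, y with
  | inl x, inl y => e x y
  | inr b, inl y | inl y, inr b => if b then y \in Na else y \in Nc
  | inr _, inr _ => false
  end.

Section Extend.
Variables (U : finType) (G : graph U) (Na Nc : {set U}).
Let R := extend (adj G) Na Nc.

Lemma extend_sym : symmetric R.
Proof. by move=> [x|b] [y|d] //=; rewrite adj_sym. Qed.

Lemma extend_irr : irreflexive R.
Proof. by move=> [x|b] //=; rewrite adj_irr. Qed.

Lemma adj_extend (V : {set U + bool}) x y :
  adj (gr V R) x y = [&& x \in V, y \in V & R x y].
Proof.
rewrite adj_gr; last exact: extend_sym.
by have [->|//] := eqVneq x y; rewrite extend_irr !andbF.
Qed.

End Extend.

(** Used with an [f] that sends an additional vertex to a vertex of [G] playing its role.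
    Injectivity of [f] is not asked for, since it is automatic on the vertices of a pattern. *)
Lemma free_embed (U W : finType) (G : graph U) (H : graph W) (f : W -> U) :
  {in vertices H &, forall x y, adj G (f x) (f y) = adj H x y} ->
  free (adj G) -> free (adj H).
Proof.
move=> fA [f1 f2].
have Q (M : rel nat) : twin_free M -> induces M (adj H) -> induces M (adj G).
  move=> tf [v hv]; exists (f \o v) => i j i5 j5 /=.
  by rewrite fA ?hv //; apply: (induces_in tf hv).
by split=> [/(@Q path_rel isT)|/(@Q house_rel isT)].
Qed.

Lemma isomorphic_lift (U : finType) (G : graph U) (Na Nc : {set U}) :
  isomorphic (gr (inl @: vertices G) (extend (adj G) Na Nc)) G.
Proof.
apply: isomorphic_sym; apply: (@isomorphicI _ _ _ _ inl) => // [x y _ _ []//|x y xV yV].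
by rewrite adj_extend !imset_f.
Qed.

Section Pieces.
Variables (U : finType) (G : graph U) (A B C L T : {set U}).
Let R := extend (adj G) B L.
Let a : U + bool := inr true.
Let c : U + bool := inr false.

(** Type 0 is the additional vertex a, and 1, 2, 3, 4 are B, C, L, T. The difference from
    [unif_table] is the entry for 0 and 3: a has no neighbour in L. *)
Definition piece_table (i j : nat) : option bool :=
  match i, j with
  | 0, 2 | 2, 0 | 0, 3 | 3, 0 | 0, 4 | 4, 0 | 4, 2 | 2, 4 | 4, 4 => Some false
  | 0, 1 | 1, 0 | 3, 1 | 1, 3 | 3, 2 | 2, 3 | 3, 3 => Some true
  | _, _ => None
  end.

Hypothesis dis : pairwise (fun X Y : {set U} => [disjoint X & Y]) [:: A; B; C; L; T].
Hypothesis LL : {in L &, forall x y, x != y -> adj G x y}.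
Hypothesis TT : {in T &, forall x y, ~~ adj G x y}.
Hypothesis AT : {in A & T, forall x y, ~~ adj G x y}.
Hypothesis AB : {in A & B, forall x y, adj G x y}.
Hypothesis AC : {in A & C, forall x y, ~~ adj G x y}.
Hypothesis LBC : {in L & B :|: C, forall x y, adj G x y}.
Hypothesis TC : {in T & C, forall x y, ~~ adj G x y}.

Let dBC : [disjoint B & C]. Proof. by move: dis => /= /and5P[_ /and4P[]]. Qed.
Let dBL : [disjoint B & L]. Proof. by move: dis => /= /and5P[_ /and4P[]]. Qed.
Let dBT : [disjoint B & T]. Proof. by move: dis => /= /and5P[_ /and4P[]]. Qed.
Let dAL : [disjoint A & L]. Proof. by move: dis => /= /and5P[/and5P[]]. Qed.
Let dLT : [disjoint L & T]. Proof. by move: dis => /= /and5P[_ _ _ /andP[]]. Qed.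

(** Inside [A :|: L :|: T] a vertex of [C] sees exactly [L], so it can play the role of c. *)
Lemma free_piece1 c0 : c0 \in C -> free (adj G) ->
  free (adj (gr (inl @: (A :|: L :|: T) :|: [set c]) R)).
Proof.
move=> c0C; apply: (@free_embed _ _ _ _ (fun z => if z is inl x then x else c0)) => x y xV yV.
rewrite adj_extend xV yV /=.
have Q z : z \in A :|: L :|: T -> adj G c0 z = (z \in L).
  rewrite !inE -orbA => /or3P[zA|zL|zT]; rewrite adj_sym.
  - by rewrite (negbTE (AC zA c0C)) (disjointFr dAL).
  - by rewrite zL LBC // inE c0C orbT.
  by rewrite (negbTE (TC zT c0C)) (disjointFl dLT).
move: xV yV; rewrite !in_setU !in_set1.
have ic b z : (inr b : U + bool) \in inl @: (z : {set U}) = false.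
  by apply/imsetP => -[].
case: x => [x|[]]; case: y => [y|[]]; rewrite ?ic //= ?orbF ?(mem_imset _ _ inl_inj).
- by move=> /Q; rewrite adj_sym.
- by move=> _ /Q.
by rewrite adj_irr.
Qed.

(** Here no single vertex of [A] need play the role of a. By enumeration a pattern through a has at
    most one vertex in [L], and a nonneighbour of that vertex in [A] replaces a in this pattern. *)
Lemma free_piece2 : A != set0 -> {in L, forall x, exists2 a, a \in A & ~~ adj G x a} ->
  free (adj G) -> free (adj (gr (inl @: (B :|: C :|: L :|: T) :|: [set a]) R)).
Proof.
move=> /set0Pn[a1 a1A] Lnon [f1 f2].
set H := gr _ _.
pose sets : seq {set U + bool} := [:: [set a]; inl @: B; inl @: C; inl @: L; inl @: T].
pose cls x := find (fun X : {set U + bool} => x \in X) sets.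
have ic b z : (inr b : U + bool) \in inl @: (z : {set U}) = false.
  by apply/imsetP => -[].
have il (z : U) X : (inl z : U + bool) \in inl @: (X : {set U}) = (z \in X).
  exact: mem_imset inl_inj.
have cls5 x : x \in vertices H -> cls x < 5 /\ x \in nth set0 sets (cls x).
  move=> xG; have h : has (fun X : {set U + bool} => x \in X) sets.
    move: xG; rewrite !in_setU in_set1 /= in_set1 orbF.
    case: x => [x|b]; rewrite ?il ?ic ?orbF //= ?inE.
    by move=> /orP[/orP[/orP[]|]|] ->; rewrite ?orbT.
  split.
    by move: h; rewrite has_find.
  exact: (nth_find set0 h).
have tbP k l b x y : piece_table k l = Some b -> x \in nth set0 sets k ->
    y \in nth set0 sets l -> x != y -> R x y = b.
  case: k => [|[|[|[|[|k]]]]] //; case: l => [|[|[|[|[|l]]]]] //= [<-];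
  rewrite ?in_set1; case: x => [x|x]; case: y => [y|y]; rewrite ?il ?ic //= => hx hy n.
  - by move/eqP: hx => [->]; rewrite hy.
  - by move/eqP: hx => [->]; rewrite (disjointFl dBC).
  - by move/eqP: hx => [->]; rewrite (disjointFl dBL).
  - by move/eqP: hx => [->]; rewrite (disjointFl dBT).
  - by move/eqP: hy => [->]; rewrite hx.
  - by rewrite adj_sym LBC // inE hx.
  - by move/eqP: hy => [->]; rewrite (disjointFl dBC).
  - by rewrite adj_sym LBC // inE hx orbT.
  - by rewrite adj_sym; apply/negbTE/TC.
  - by move/eqP: hy => [->]; rewrite (disjointFl dBL).
  - by rewrite LBC // inE hy.
  - by rewrite LBC // inE hy orbT.
  - by rewrite LL.
  - by move/eqP: hy => [->]; rewrite (disjointFl dBT).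
  - by apply/negbTE/TC.
  by apply/negbTE/TT.
have Q (M : rel nat) : twin_free M ->
    all5 5 (fun t => consistent piece_table M t && at_most_one 0 t ==>
              all_lt 5 (fun i => t i != 0) || at_most_one 3 t) ->
    induces M (adj H) -> induces M (adj G).
  move=> tf ck [v hv]; have vH := induces_in tf hv.
  have [i i5|t tP te] := @all5P _ _ (fun i => cls (v i)) ck; first by case: (cls5 _ (vH i i5)).
  have tS i : i < 5 -> v i \in nth set0 sets (t i) by move=> i5; rewrite te //; case: (cls5 _ (vH i i5)).
  have t5 i : i < 5 -> t i < 5 by move=> i5; rewrite te //; case: (cls5 _ (vH i i5)).
  have vR i j : i < 5 -> j < 5 -> R (v i) (v j) = M i j.
    by move=> i5 j5; rewrite -hv // adj_extend !vH.
  have co : consistent piece_table M t.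
    apply/all2_5P => i j i5 j5; have [//|nij] := eqVneq i j.
    case E: (piece_table _ _) => [b|] //=; rewrite -vR // (tbP _ _ _ _ _ E) ?tS //.
    by apply: contra nij => /eqP /(induces_inj tf hv)->.
  have o0 : at_most_one 0 t.
    apply/all2_5P => i j i5 j5; apply/implyP => /andP[/eqP ti /eqP tj].
    have := tS i i5; have := tS j j5; rewrite ti tj /= !in_set1 => /eqP <- /eqP.
    by move/(induces_inj tf hv)->.
  have t0P i : i < 5 -> v i = a -> t i = 0.
    move=> i5 E; have := tS i i5; have := t5 i i5; rewrite E.
    by case: (t i) => [|[|[|[|[|]]]]] //=; rewrite ic.
  (* The replacement depends on the pattern: a nonneighbour of its vertex in [L] if there is one,
     and the arbitrary [a1] otherwise. *)
  have [a0 a0A a0P] : exists2 a0, a0 \in A & forall i j x, i < 5 -> j < 5 -> v i = a ->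
      v j = inl x -> x \in L -> ~~ adj G a0 x.
    have [/hasP[j]|/hasPn nh] := boolP (has (fun j => t j == 3) (iota 0 5)).
      rewrite mem_iota => /andP[_ j5] /eqP tj; have := tS j j5; rewrite tj /=.
      case/imsetP => x xL vj; have [a0 a0A na] := Lnon x xL.
      exists a0 => // i k y i5 k5 va vk yL.
      have tk : t k = 3.
        have := tS k k5; have := t5 k k5; rewrite vk.
        case: (t k) => [|[|[|[|[|]]]]] //=; rewrite ?il ?inE //.
        - by rewrite (disjointFl dBL).
        - by move=> _ yC; move: dis => /= /and5P[_ _ /and3P[d _ _] _ _]; rewrite (disjointFr d) in yL.
        by rewrite (disjointFr dLT).
      move: tP; rewrite co o0 /= => /orP[/all_ltP/(_ i i5)|/at_most_oneP h].
        by rewrite (t0P i).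
      have E := h _ _ j5 k5 tj tk; move: vk; rewrite -E vj => -[<-].
      by rewrite adj_sym.
    exists a1 => // i j x i5 j5 va vj xL.
    have jl : j \in iota 0 5 by rewrite mem_iota.
    have := tS j j5; have := nh j jl; have := t5 j j5; rewrite vj.
    case: (t j) => [|[|[|[|[|]]]]] //=; rewrite ?il ?inE //.
    - by rewrite (disjointFl dBL).
    - by move=> _ _ xC; move: dis => /= /and5P[_ _ /and3P[d _ _] _ _]; rewrite (disjointFr d) in xL.
    by rewrite (disjointFr dLT).
  have aP i j x : i < 5 -> j < 5 -> v i = a -> v j = inl x -> adj G a0 x = M i j.
    move=> i5 j5 vi vj; rewrite -vR // vi vj /=.
    have := vH j j5; rewrite in_setU in_set1 vj il !inE orbF => /orP[/orP[/orP[]|]|] h.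
    - by rewrite h AB.
    - by rewrite (disjointFl dBC) // (negbTE (AC a0A h)).
    - by rewrite (disjointFl dBL) // (negbTE (a0P _ _ _ i5 j5 vi vj h)).
    by rewrite (disjointFl dBT) // (negbTE (AT a0A h)).
  exists (fun i => if v i is inl x then x else a0) => i j i5 j5.
  have va k b : k < 5 -> v k = inr b -> v k = a.
    by move=> k5 E; have := vH k k5; rewrite in_setU in_set1 E ic => /eqP.
  case vi: (v i) => [x|b]; case vj: (v j) => [y|d].
  - by rewrite -vR // vi vj.
  - rewrite adj_sym (aP j i x j5 i5 (va j d j5 vj) vi).
    by rewrite -(vR j i j5 i5) -(vR i j i5 j5); apply: extend_sym.
  - by rewrite (aP i j y i5 j5 (va i b i5 vi) vj).
  by rewrite adj_irr -(vR i j i5 j5) (va i b i5 vi) (va j d j5 vj).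
have cp : all5 5 (fun t => consistent piece_table path_rel t && at_most_one 0 t ==>
              all_lt 5 (fun i => t i != 0) || at_most_one 3 t).
  vm_compute; exact (erefl true).
have ch : all5 5 (fun t => consistent piece_table house_rel t && at_most_one 0 t ==>
              all_lt 5 (fun i => t i != 0) || at_most_one 3 t).
  vm_compute; exact (erefl true).
by split=> [/(@Q path_rel isT cp)|/(@Q house_rel isT ch)].
Qed.

End Pieces.

Section Lift.
Variable U : finType.
Implicit Types X Y : {set U}.

Lemma mem_inl X (x : U) : ((inl x : U + bool) \in inl @: X) = (x \in X).
Proof. exact: mem_imset inl_inj. Qed.

Lemma mem_inr X (b : bool) : ((inr b : U + bool) \in inl @: X) = false.
Proof. by apply/imsetP => -[]. Qed.

Lemma card_inl X : #|inl @: X : {set U + bool}| = #|X|.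
Proof. exact: card_imset inl_inj. Qed.

Lemma disjoint_inl X Y :
  [disjoint (inl @: X : {set U + bool}) & inl @: Y] = [disjoint X & Y].
Proof.
apply/pred0P/pred0P => h x; first by have := h (inl x); rewrite /= !mem_inl.
by case: x => [x|b]; rewrite /= ?mem_inl ?mem_inr //; apply: h.
Qed.

Lemma inl_cup X Y : inl @: X :|: inl @: Y = inl @: (X :|: Y) :> {set U + bool}.
Proof. by rewrite imsetU. Qed.

Lemma setU1_inrK X b : (inl @: X :|: [set inr b]) :\ inr b = inl @: X :> {set U + bool}.
Proof.
by apply/setP => -[x|d]; rewrite !inE ?mem_inl ?mem_inr ?orbF //=; case: (_ == _).
Qed.

Lemma card_setU1_inr X b : #|(inl @: X : {set U + bool}) :|: [set inr b]| = #|X|.+1.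
Proof.
rewrite setUC cardsU1 mem_inr add1n; congr _.+1; exact: card_inl.
Qed.

End Lift.

(** The ambient type grows by two elements to make room for a and c. One piece trades [B :|: C] for
    c and the other trades [A] for a; as both sets have at least two elements, both pieces are
    smaller than [G]. *)
Lemma divided_unification (U : finType) (G : graph U) :
  free (adj G) -> divided (vertices G) (adj G) ->
  exists G1 G2 G' : graph (U + bool)%type,
    [/\ split_graph_unification G1 G2 G', isomorphic G' G,
        free (adj G1) /\ free (adj G2),
        #|vertices G1| < #|vertices G| & #|vertices G2| < #|vertices G| ].
Proof.
move=> fG [A [B [C [L [T [[dis GV A2 C0 BC2] [[LL TT AT AB AC] [LBC TC Lnon]]]]]]]].
have A0 : A != set0 by rewrite -card_gt0 ltnW.
pose R := extend (adj G) B L.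
have Rs : symmetric R by exact: extend_sym.
pose a : U + bool := inr true; pose c : U + bool := inr false.
pose V1 : {set U + bool} := inl @: (A :|: L :|: T) :|: [set c].
pose V2 : {set U + bool} := inl @: (B :|: C :|: L :|: T) :|: [set a].
have card5 : #|vertices G| = #|A :|: L :|: T| + #|B :|: C|.
  have d : [disjoint A :|: L :|: T & B :|: C].
    move: dis => /= /and5P[/and5P[dAB dAC _ _ _] /and4P[dBC dBL dBT _] /and3P[dCL dCT _] _ _].
    by rewrite !disjoints_subset !subUset -!disjoints_subset ![[disjoint _ & B :|: C]]disjoint_sym
      !disjoints_subset !subUset -!disjoints_subset ![[disjoint _ & A]]disjoint_sym dAB dAC dBL dBT dCL dCT.
  rewrite -cardsUI (disjoint_setI0 d) cards0 addn0 GV; apply: eq_card => x; rewrite !inE.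
  by case: (x \in A); case: (x \in B); case: (x \in C); case: (x \in L); case: (x \in T).
have card5' : #|vertices G| = #|B :|: C :|: L :|: T| + #|A|.
  have d : [disjoint A & B :|: C :|: L :|: T].
    move: dis => /= /and5P[/and5P[dAB dAC dAL dAT _] _ _ _ _].
    by rewrite disjoint_sym !disjoints_subset !subUset -!disjoints_subset ![[disjoint _ & A]]disjoint_sym dAB dAC dAL dAT.
  rewrite addnC -cardsUI (disjoint_setI0 d) cards0 addn0 GV; apply: eq_card => x; rewrite !inE.
  by case: (x \in A); case: (x \in B); case: (x \in C); case: (x \in L); case: (x \in T).
exists (gr V1 R), (gr V2 R), (gr (inl @: vertices G) R); split; last 4 first.
- exact: isomorphic_lift.
- split; last exact: (free_piece2 dis LL TT AT AB AC LBC TC A0 Lnon fG).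
  by have /set0Pn[c0 c0C] := C0; exact: (free_piece1 dis AC LBC TC c0C fG).
- by rewrite [#|_|]card_setU1_inr card5 -addn1 ltn_add2l.
- by rewrite [#|_|]card_setU1_inr card5' -addn1 ltn_add2l.
exists (inl @: A), (inl @: B), (inl @: C), (inl @: L), (inl @: T), a, c.
have mem1 (X : {set U}) : X \subset A :|: L :|: T -> inl @: X \subset V1.
  move=> /subsetP h; apply/subsetP => _ /imsetP[x xX ->].
  by rewrite in_setU mem_inl h.
have mem2 (X : {set U}) : X \subset B :|: C :|: L :|: T -> inl @: X \subset V2.
  move=> /subsetP h; apply/subsetP => _ /imsetP[x xX ->].
  by rewrite in_setU mem_inl h.
have sA1 : A \subset A :|: L :|: T by rewrite -setUA subsetUl.
have sL1 : L \subset A :|: L :|: T by rewrite setUAC subsetUr.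
have sT1 : T \subset A :|: L :|: T by rewrite subsetUr.
have sC2 : C \subset B :|: C :|: L :|: T by rewrite -!setUA (subset_trans _ (subsetUr _ _)) ?subsetUl.
have sB2 : B \subset B :|: C :|: L :|: T by rewrite -!setUA subsetUl.
have sL2 : L \subset B :|: C :|: L :|: T by rewrite setUAC subsetUr.
have sT2 : T \subset B :|: C :|: L :|: T by rewrite subsetUr.
have c1 : c \in V1 by rewrite in_setU in_set1 eqxx orbT.
have a2 : a \in V2 by rewrite in_setU in_set1 eqxx orbT.
have dAB : [disjoint A & B] by move: dis => /= /and5P[/and5P[]].
have dAC : [disjoint A & C] by move: dis => /= /and5P[/and5P[]].
have dAT : [disjoint A & T] by move: dis => /= /and5P[/and5P[]].
have dAL : [disjoint A & L] by move: dis => /= /and5P[/and5P[]].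
have dLT : [disjoint L & T] by move: dis => /= /and5P[_ _ _ /andP[]].
have dTC : [disjoint T & C] by move: dis => /= /and5P[_ _ /and3P[_ d _] _ _]; rewrite disjoint_sym.
have dBC : [disjoint B & C] by move: dis => /= /and5P[_ /and4P[]].
have dBL : [disjoint B & L] by move: dis => /= /and5P[_ /and4P[]].
have dBT : [disjoint B & T] by move: dis => /= /and5P[_ /and4P[]].
have dCL : [disjoint C & L] by move: dis => /= /and5P[_ _ /and3P[]].
have compl_ (V : {set U + bool}) (X Y : {set U}) : inl @: X \subset V -> inl @: Y \subset V ->
    [disjoint X & Y] -> {in X & Y, forall x y, adj G x y} ->
    complete (gr V R) (inl @: X) (inl @: Y).
  move=> /subsetP sX /subsetP sY dXY h; rewrite /complete disjoint_inl dXY /=.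
  apply/forall_inP => _ /imsetP[x xX ->]; rewrite /vcomplete mem_inl (disjointFr dXY) //=.
  apply/forall_inP => _ /imsetP[y yY ->]; rewrite adj_extend sX ?sY ?imset_f //=.
  exact: h.
have anti_ (V : {set U + bool}) (X Y : {set U}) : [disjoint X & Y] ->
    {in X & Y, forall x y, ~~ adj G x y} ->
    anticomplete (gr V R) (inl @: X) (inl @: Y).
  move=> dXY h; rewrite /anticomplete disjoint_inl dXY /=.
  apply/forall_inP => _ /imsetP[x xX ->]; rewrite /vanticomplete mem_inl (disjointFr dXY) //=.
  apply/forall_inP => _ /imsetP[y yY ->]; rewrite adj_extend /=.
  by rewrite (negbTE (h _ _ xX yY)) !andbF.
split; last split.
- split.
  + by rewrite /= !disjoint_inl.
  + by rewrite -card_gt0 card_inl card_gt0.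
  + by rewrite -card_gt0 card_inl card_gt0.
  + by [].
  + by rewrite !inE !mem_inr.
  + by rewrite !inE !mem_inr.
  + by rewrite /= !inl_cup.
  + rewrite /clique mem1 //=; apply/forall_inP => _ /imsetP[x xL ->].
    apply/forall_inP => _ /imsetP[y yL ->]; apply/implyP => n.
    rewrite adj_extend !(subsetP (mem1 _ sL1)) ?imset_f //=.
    by apply: LL => //; apply: contra n => /eqP->.
  + rewrite /stable mem1 //=; apply/forall_inP => _ /imsetP[x xL ->].
    apply/forall_inP => _ /imsetP[y yL ->].
    by rewrite adj_extend /= (negbTE (TT _ _ xL yL)) !andbF.
  + exact: anti_.
  + rewrite /vcomplete mem_inr; apply/forall_inP => _ /imsetP[x xL ->].
    by rewrite adj_extend c1 (subsetP (mem1 _ sL1)) ?imset_f.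
  + rewrite /vanticomplete inl_cup mem_inr; apply/forall_inP => _ /imsetP[x xL ->].
    rewrite adj_extend /=; case/setUP: xL => xL.
      by rewrite (disjointFr dAL) ?andbF.
    by rewrite (disjointFl dLT) ?andbF.
  + by rewrite /= !inl_cup.
  + rewrite inl_cup !induced_gr //; [apply: mem1 | apply: mem2]; by rewrite subUset ?sL1 ?sL2.
  + exact: anti_.
  + rewrite inl_cup; apply: compl_ => //; try apply: mem2 => //.
    * by rewrite -!setUA setUA subsetUl.
    * by rewrite disjoint_sym !disjoints_subset subUset -!disjoints_subset dBL dCL.
  + rewrite /vcomplete mem_inr; apply/forall_inP => _ /imsetP[x xB ->].
    by rewrite adj_extend a2 (subsetP (mem2 _ sB2)) ?imset_f.
  rewrite /vanticomplete !inl_cup mem_inr; apply/forall_inP => _ /imsetP[x xL ->].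
  rewrite adj_extend /=; case/setUP: xL => [/setUP[]|] xL.
  + by rewrite (disjointFl dBC) ?andbF.
  + by rewrite (disjointFl dBL) ?andbF.
  by rewrite (disjointFl dBT) ?andbF.
- by rewrite /= !inl_cup -GV.
- rewrite !inl_cup del_vertex_gr // setU1_inrK induced_gr //; apply: imsetS; rewrite GV.
  by apply/subsetP => x; rewrite !inE => /orP[/orP[]|] ->; rewrite ?orbT.
- rewrite !inl_cup del_vertex_gr // setU1_inrK induced_gr //; apply: imsetS; rewrite GV.
  by apply/subsetP => x; rewrite !inE => /orP[/orP[/orP[]|]|] ->; rewrite ?orbT.
- apply: compl_ => //; apply: imsetS; rewrite GV; apply/subsetP => x xX; rewrite !inE xX ?orbT //.
- exact: anti_.
Qed.

Definition homogeneous (U : finType) (V X : {set U}) (e : rel U) : Prop :=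
  [/\ X \subset V, 1 < #|X|, #|X| < #|V|
    & forall v x y, v \in V :\: X -> x \in X -> y \in X -> e v x = e v y].

Lemma homogeneous_substitution (U : finType) (G : graph U) (X : {set U}) :
  free (adj G) -> homogeneous (vertices G) X (adj G) ->
  exists (G1 G2 G' : graph (U + bool)%type) u,
    [/\ substitution G1 G2 u G', isomorphic G' G,
        free (adj G1) /\ free (adj G2),
        #|vertices G1| < #|vertices G| & #|vertices G2| < #|vertices G| ].
Proof.
move=> fG [XV X2 XG hX].
have /card_gt0P[x0 x0X] : 0 < #|X| by apply: ltnW.
(* By homogeneity these are the common neighbours of all of [X]; they become the neighbours of the
   vertex [u] that stands for [X]. *)
pose N := [set v in vertices G :\: X | adj G v x0].
pose R := extend (adj G) N set0.
have Rs : symmetric R by exact: extend_sym.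
pose u : U + bool := inr true.
pose V2 : {set U + bool} := inl @: (vertices G :\: X) :|: [set u].
exists (gr (inl @: X) R), (gr V2 R), (gr (inl @: vertices G) R), u; split; last 4 first.
- exact: isomorphic_lift.
- split.
    apply: (@free_embed _ _ _ _ (fun z => if z is inl x then x else x0)) fG => x y /=.
    move=> xV yV; rewrite adj_extend xV yV.
    by case/imsetP: xV => ? _ ->; case/imsetP: yV => ? _ ->.
  apply: (@free_embed _ _ _ _ (fun z => if z is inl x then x else x0)) fG => x y /=.
  move=> xV yV; rewrite adj_extend xV yV.
  move: xV yV; rewrite !in_setU !in_set1.
  case: x => [x|b]; case: y => [y|d]; rewrite ?mem_inl ?mem_inr ?orbF //=.
  + by move=> xV /eqP[->]; move: xV; rewrite !inE => ->.
  + by move=> /eqP[->] xV; rewrite adj_sym; move: xV; rewrite !inE => ->.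
  by rewrite adj_irr.
- by rewrite [#|_|]card_inl.
- rewrite [#|_|]card_setU1_inr -(cardsID X (vertices G)) (setIidPr XV).
  by move: X2; rewrite -(ltn_add2r #|vertices G :\: X|) add1n.
split.
- apply/pred0P => -[x|b]; rewrite /= !inE ?mem_inl ?mem_inr //= orbF.
  by rewrite !inE; case: (x \in X).
- by rewrite !inE eqxx orbT.
- rewrite /= setU1_inrK inl_cup; suff <- : vertices G = X :|: (vertices G :\: X) by [].
  by apply/setP => x; rewrite !inE; case: (boolP (x \in X)) => //= /(subsetP XV)->.
- have e2 : V2 :\ u = inl @: (vertices G :\: X) by exact: setU1_inrK.
  split; first by rewrite induced_gr //; apply: imsetS.
  by rewrite del_vertex_gr //= e2 induced_gr //; apply/imsetS/subsetDl.
rewrite /= setU1_inrK => _ /imsetP[v vX ->].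
have vG : v \in vertices G by case/setDP: vX.
have v2 : inl v \in V2 by rewrite in_setU mem_inl vX.
have u2 : u \in V2 by rewrite in_setU in_set1 eqxx orbT.
rewrite adj_extend v2 u2 /= in_set vX /=.
have vnX : v \notin X by case/setDP: vX.
case: ifP => av; rewrite /vcomplete /vanticomplete mem_inl vnX;
  apply/forall_inP => _ /imsetP[x xX ->]; rewrite adj_extend !mem_inl vG (subsetP XV) //=.
  by rewrite (hX v x x0).
by rewrite (hX v x x0) // av.
Qed.

(** * Pentagons and split graphs *)

Definition prime_graph (U : finType) (G : graph U) : Prop :=
  forall X, ~ homogeneous (vertices G) X (adj G).

(** The four vertices are automatically distinct; [a = c], for instance, would make [b] adjacent to
    [c]. For the complement of a graph this describes an induced C4 of the graph itself. *)
Definition has_2K2 (U : finType) (G : graph U) : Prop :=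
  exists a b c d, [&& adj G a b, adj G c d, ~~ adj G a c, ~~ adj G a d,
                      ~~ adj G b c & ~~ adj G b d].

Section Patterns.
Variables (U : finType) (G : graph U).
Local Notation e := (adj G).

Lemma induces_path a b c d f : e a b -> e b c -> e c d -> e d f ->
  ~~ e a c -> ~~ e a d -> ~~ e a f -> ~~ e b d -> ~~ e b f -> ~~ e c f ->
  induces path_rel e.
Proof.
move=> ab bc cd df /negbTE ac /negbTE ad /negbTE af /negbTE bd /negbTE bf /negbTE cf.
exists (nth a [:: a; b; c; d; f]); move=> [|[|[|[|[|i]]]]] [|[|[|[|[|j]]]]] //= _ _;
  by rewrite ?adj_irr //= 1?adj_sym ?ab ?bc ?cd ?df ?ac ?ad ?af ?bd ?bf ?cf //
     1?adj_sym ?ab ?bc ?cd ?df ?ac ?ad ?af ?bd ?bf ?cf.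
Qed.

(* In the complement of the house, a c t d b is the induced path. *)
Lemma induces_house a b c d t : e a b -> e b c -> e c d -> e d a ->
  ~~ e a c -> ~~ e b d -> e t a -> e t b -> ~~ e t c -> ~~ e t d ->
  induces house_rel e.
Proof.
move=> ab bc cd da /negbTE ac /negbTE bd ta tb /negbTE tc /negbTE td.
exists (nth a [:: a; c; t; d; b]); move=> [|[|[|[|[|i]]]]] [|[|[|[|[|j]]]]] //= _ _;
  by rewrite ?adj_irr //= 1?adj_sym ?ab ?bc ?cd ?da ?ac ?bd ?ta ?tb ?tc ?td //
     1?adj_sym ?ab ?bc ?cd ?da ?ac ?bd ?ta ?tb ?tc ?td.
Qed.

Lemma induces_pentagon a b c d f : e a b -> e b c -> e c d -> e d f -> e f a ->
  ~~ e a c -> ~~ e a d -> ~~ e b d -> ~~ e b f -> ~~ e c f ->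
  induces pent_rel e.
Proof.
move=> ab bc cd df fa /negbTE ac /negbTE ad /negbTE bd /negbTE bf /negbTE cf.
exists (nth a [:: a; b; c; d; f]); move=> [|[|[|[|[|i]]]]] [|[|[|[|[|j]]]]] //= _ _;
  by rewrite ?adj_irr //= 1?adj_sym ?ab ?bc ?cd ?df ?ac ?ad ?fa ?bd ?bf ?cf //
     1?adj_sym ?ab ?bc ?cd ?df ?ac ?ad ?fa ?bd ?bf ?cf.
Qed.

End Patterns.

(** * Prime free graphs containing a pentagon *)

Section Pentagon.
Variables (U : finType) (G : graph U).
Local Notation e := (adj G).
Hypothesis fG : free e.
Hypothesis pG : prime_graph G.

Lemma all5I n (P : pred (nat -> nat)) :
  (forall t, (forall i, i < 5 -> t i < n) -> P t) -> all5 n P.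
Proof.
move=> h; apply/all_ltP => a an; apply/all_ltP => b bn; apply/all_ltP => c cn.
apply/all_ltP => d dn; apply/all_ltP => f fn; apply: h.
by case=> [|[|[|[|[|]]]]].
Qed.

(* Adjacency in a pentagon 0..4 together with a vertex 5 whose neighbours in the
   pentagon are those i with b i = 1. *)
Definition wheel_rel (b : nat -> nat) : rel nat := fun i j =>
  match i == 5, j == 5 with
  | true, true => false
  | true, false => b j == 1
  | false, true => b i == 1
  | _, _ => pent_rel i j
  end.

Definition wheel_free (b : nat -> nat) : bool :=
  all5 6 (fun t =>
    ~~ all2_5 (fun i j => wheel_rel b (t i) (t j) == path_rel i j) &&
    ~~ all2_5 (fun i j => wheel_rel b (t i) (t j) == house_rel i j)).

(* The condition says nothing about b k: a twin of k may be adjacent to it or not. *)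
Definition pent_twin (b : nat -> nat) (k : nat) : bool :=
  all_lt 5 (fun i => (i == k) || ((b i == 1) == pent_rel k i)).

(** The negations in the last disjunct express that some [k] below 5 satisfies [pent_twin b k]. *)
Definition pent_allowed (b : nat -> nat) : bool :=
  [|| all_lt 5 (fun i => b i == 0), all_lt 5 (fun i => b i == 1)
    | ~~ all_lt 5 (fun k => ~~ pent_twin b k)].

Lemma wheel_free_allowed : all5 2 (fun b => wheel_free b ==> pent_allowed b).
Proof. by vm_compute. Qed.

(** The two neighbourhoods are those of one vertex in two pentagons that differ by a twin at
    position [k]. A vertex seeing one twin but not the other must itself be a twin of [k]. *)
Lemma pent_allowed_twin : all5 2 (fun b => all_lt 5 (fun k =>
  [&& b k == 1, pent_allowed b & pent_allowed (fun i => if i == k then 0 else b i)]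
    ==> pent_twin b k)).
Proof. by vm_compute. Qed.

Definition pent_in (v : nat -> U) : Prop :=
  forall i j, i < 5 -> j < 5 -> e (v i) (v j) = pent_rel i j.

Lemma pent_nbrs v w : pent_in v ->
  exists2 b : nat -> nat, pent_allowed b & forall i, i < 5 -> b i = e w (v i).
Proof.
move=> hv.
have [i _|b bP be] := @all5P _ _ (fun i => e w (v i) : nat) wheel_free_allowed.
  by case: (e w (v i)).
exists b => //; move: bP => /implyP; apply.
pose x i := if i == 5 then w else v i.
have E t : (forall i, i < 5 -> t i < 6) -> forall i j, i < 5 -> j < 5 ->
    e (x (t i)) (x (t j)) = wheel_rel b (t i) (t j).
  move=> t6 i j i5 j5; rewrite /x /wheel_rel.
  have := t6 i i5; have := t6 j j5; rewrite ltnS leq_eqVlt; case: eqP => [_ _|_ /= tj];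
    rewrite ltnS leq_eqVlt; case: eqP => [_ _|_ /= ti].
  - exact: adj_irr.
  - by rewrite adj_sym be // eqb1.
  - by rewrite be // eqb1.
  exact: hv.
case: fG => f1 f2; apply: all5I => t t6; apply/andP; split; apply/negP => /all2_5P h.
  by apply: f1; exists (x \o t) => i j i5 j5 /=; rewrite E //; apply/eqP/h.
by apply: f2; exists (x \o t) => i j i5 j5 /=; rewrite E //; apply/eqP/h.
Qed.

(** The set [X] of all twins of [v k], including [v k], would be homogeneous if it had two elements:
    by [pent_allowed_twin] a vertex distinguishing two of them belongs to [X]. *)
Lemma twin_class v k w : pent_in v -> k < 5 -> w \in vertices G ->
  (forall i, i < 5 -> i != k -> e w (v i) = pent_rel k i) -> w = v k.
Proof.
move=> hv k5 wG wk; have tc : twin_free pent_rel by [].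
have vG := induces_in tc hv.
pose X := [set x in vertices G | all_lt 5 (fun i => (i == k) || (e x (v i) == pent_rel k i))].
have XP x i : x \in X -> i < 5 -> i != k -> e x (v i) = pent_rel k i.
  rewrite inE => /andP[_ /all_ltP h] i5 /negbTE nik.
  by have := h i i5; rewrite nik => /eqP.
have vkX : v k \in X.
  rewrite inE vG //=; apply/all_ltP => i i5; rewrite hv //.
  by rewrite eqxx orbT.
have wX : w \in X.
  rewrite inE wG; apply/all_ltP => i i5; have [//|nik] := eqVneq i k.
  by rewrite wk // eqxx.
have XG : X \subset vertices G by apply/subsetP => x; rewrite inE => /andP[].
apply/eqP; apply: contraPT (pG (X := X)) => nwk; apply; split => //.
- by apply/card_gt1P; exists w, (v k).
(* The successor of [k] on the cycle is not in [X], because membership would make it adjacent to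
   itself. *)
- apply: proper_card; rewrite properE XG; apply/subsetPn; exists (v (k.+1 %% 5)).
    by apply: vG; rewrite ltn_mod.
  apply/negP => h; have l : k.+1 %% 5 < 5 by rewrite ltn_mod.
  have nk : k.+1 %% 5 != k by move: k5; case: k {wk X XP vkX wX XG nwk h l} => [|[|[|[|[|]]]]].
  by have := XP _ _ h l nk; rewrite adj_irr /pent_rel eqxx.
have pent_upd x : x \in X -> pent_in (fun i => if i == k then x else v i).
  move=> xX i j i5 j5; have [->|ni] := eqVneq i k; have [->|nj] := eqVneq j k.
  - by rewrite adj_irr -(hv k k) // adj_irr.
  - exact: XP.
  - by rewrite adj_sym XP // -!hv // adj_sym.
  exact: hv.
have Q z x y : z \in vertices G :\: X -> x \in X -> y \in X -> e z x -> e z y.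
  case/setDP=> zG zX xX yX zx; apply: contraNT zX => zy.
  have [b bA be] := pent_nbrs z (pent_upd x xX).
  have [b' bA' be'] := pent_nbrs z (pent_upd y yX).
  have b2 i : i < 5 -> b i < 2 by move=> i5; rewrite be //; case: (e _ _).
  have [c cP ce] := all5P pent_allowed_twin b2.
  have ext (b1 b3 : nat -> nat) : (forall i, i < 5 -> b1 i = b3 i) ->
      pent_allowed b1 = pent_allowed b3.
    by move=> h; rewrite /pent_allowed /all_lt /pent_twin /all_lt /= !h.
  move/all_ltP: cP => /(_ k k5).
  rewrite ce // be // eqxx zx (ext c b) // bA (ext (fun i => if i == k then 0 else c i) b') //=.
    rewrite bA' => /all_ltP h; rewrite inE zG; apply/all_ltP => i i5.
    have [//|nik] := eqVneq i k; have := h i i5.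
    by rewrite ce // be // (negbTE nik) eqb1.
  move=> i i5; rewrite be' //; have [_|nik] := eqVneq i k.
    by rewrite (negbTE zy).
  by rewrite ce // be // (negbTE nik).
by move=> z x y zX xX yX; apply/idP/idP; apply: Q.
Qed.

(** If there were further vertices, the pentagon would be homogeneous: an outside vertex sees all or
    nothing of it, since a twin of some [v k] equals [v k] by [twin_class]. *)
Lemma prime_pentagon : induces pent_rel e -> pentagon G.
Proof.
case=> v hv; have tc : twin_free pent_rel by [].
have vG := induces_in tc hv.
apply: (pentagonP hv); set X := [set _ | i : _].
have XG : X \subset vertices G by apply/subsetP => _ /imsetP[i _ ->]; apply: vG.
apply/eqP; rewrite eqEsubset XG andbT; apply: contraPT (pG (X := X)) => nX; apply; split => //.
- apply/card_gt1P; exists (v 0), (v 1); split.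
  + exact: (imset_f (fun i : 'I_5 => v i) (x := inord 0)) || by apply/imsetP; exists (inord 0); rewrite ?inordK.
  + by apply/imsetP; exists (inord 1); rewrite ?inordK.
  by apply/eqP => /(induces_inj tc hv) E; have := E isT isT.
- by apply: proper_card; rewrite properE XG.
move=> w x y /setDP[wG wX] /imsetP[i _ ->] /imsetP[j _ ->].
have [b bA be] := pent_nbrs w hv.
case/or3P: bA => [/all_ltP h|/all_ltP h|/all_ltPn[k k5]].
- by have := h i (ltn_ord i); have := h j (ltn_ord j); rewrite !be // !eqb0 => /negbTE-> /negbTE->.
- by have := h i (ltn_ord i); have := h j (ltn_ord j); rewrite !be // !eqb1 => -> ->.
rewrite negbK => /all_ltP h.
case/negP: wX; rewrite (@twin_class v k w hv k5 wG).
  by apply/imsetP; exists (inord k); rewrite ?inordK.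
move=> l l5 nlk; have := h l l5.
by rewrite (negbTE nlk) be // eqb1 => /eqP.
Qed.

End Pentagon.

(** * Graphs without 2K2, C4 and C5 *)

Section Split.
Variables (U : finType) (G : graph U).
Local Notation e := (adj G).
Hypothesis nK2 : ~ has_2K2 G.
Hypothesis nC4 : ~ has_2K2 (compl_graph G).
Hypothesis nC5 : ~ induces pent_rel e.

Lemma no_C4 a b c d : e a b -> e b c -> e c d -> e d a -> ~~ e a c -> ~~ e b d ->
  a != c -> b != d -> False.
Proof.
move=> ab bc cd da ac bd nac nbd; apply: nC4; exists a, c, b, d.
have aG := adj_vertices ab; have bG := adj_vertices bc.
have cG := adj_vertices cd; have dG := adj_vertices da.
rewrite !adj_compl aG bG cG dG nac nbd ac bd ab cd.
by rewrite [e a d]adj_sym [e c b]adj_sym da bc !andbF.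
Qed.

(** A theorem of Foldes and Hammer. The clique [K] is of maximum size and, among those, of maximum
    degree sum; an edge outside [K] leads to one of the three forbidden graphs. *)
Lemma split_of_no_2K2_C4_C5 : split_graph G.
Proof.
pose n := #|vertices G|.
pose wt x := n + #|[set y | e x y]|.
(* The summand n makes larger cliques heavier; among cliques of equal size the
   heaviest one misses the fewest edges. *)
pose f (K : {set U}) := \sum_(x in K) wt x.
have cl0 : clique G set0.
  by rewrite /clique sub0set; apply/forall_inP => x; rewrite inE.
pose K := [arg max_(K > set0 | clique G K) f K].
have [cK Kmax] : clique G K /\ forall K', clique G K' -> f K' <= f K.
  by rewrite /K; case: arg_maxnP.
have KG : K \subset vertices G by case/andP: cK.
have KK x y : x \in K -> y \in K -> x != y -> e x y.
  by case/andP: cK => _ /forall_inP h xK yK; apply/implyP; move/forall_inP: (h x xK); apply.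
have cliqueI (K' : {set U}) z : z \in vertices G -> clique G K' ->
    (forall u, u \in K' -> e z u) -> clique G (z |: K').
  move=> zG /andP[K'G /forall_inP h] zK; rewrite /clique subUset sub1set zG K'G /=.
  apply/forall_inP => x /setU1P[->|xK]; apply/forall_inP => y /setU1P[->|yK]; apply/implyP.
  - by rewrite eqxx.
  - by rewrite zK.
  - by rewrite adj_sym zK.
  by move/forall_inP: (h x xK) => /(_ y yK)/implyP.
have nonnbr z : z \in vertices G -> z \notin K -> exists2 u, u \in K & ~~ e z u.
  move=> zG zK; apply/exists_inP; apply: contraT; rewrite negb_exists_in => /forall_inP h.
  have hz u : u \in K -> e z u by move/h; rewrite negbK.
  have := Kmax _ (cliqueI _ _ zG cK hz); rewrite /f big_setU1 //= -[leqRHS]add0n leq_add2r.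
  rewrite leqn0 addn_eq0 /n cards_eq0 => /andP[/eqP E _].
  by rewrite E inE in zG.
have wt_lt x : x \in vertices G -> wt x < n + n.
  move=> xG; rewrite ltn_add2l; apply: proper_card; apply/properP; split.
    by apply/subsetP => y; rewrite inE => /adj_verticesr.
  by exists x => //; rewrite inE adj_irr.
exists K, (vertices G :\: K); split => //.
- by rewrite setDE setUIr setUCr setIT; apply/esym/setUidPr.
- by rewrite disjoint_sym disjoints_subset subsetDr.
rewrite /stable subsetDl; apply/forall_inP => x0 /setDP[x0G x0K].
apply/forall_inP => y0 /setDP[y0G y0K]; apply/negP => xy0.
(* Excluding C4 makes the nonneighbours in [K] of the two ends of an edge outside [K] comparable by
   inclusion; [x] is the end with fewer of them. It misses exactly one vertex [u], as a second one
   would give 2K2. *)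
have main x y : x \in vertices G -> x \notin K -> y \in vertices G -> y \notin K -> e x y ->
    (forall u, u \in K -> ~~ e x u -> ~~ e y u) -> False.
  move=> xG xK yG yK xy sub.
  have [u uK xu] := nonnbr _ xG xK; have yu := sub _ uK xu.
  have xu1 v : v \in K -> v != u -> e x v.
    move=> vK vu; apply: contraT => xv; case: nK2; exists x, y, u, v.
    by rewrite xy KK 1?eq_sym // xu xv yu sub.
  have nxu : x != u by apply: contraNneq xK => ->.
  have cK1 : clique G (x |: (K :\ u)).
    apply: cliqueI => //.
      apply/andP; split; first by apply: subset_trans KG; apply: subsetDl.
      apply/forall_inP => w /setD1P[_ wK]; apply/forall_inP => z /setD1P[_ zK].
      by apply/implyP; apply: KK.
    by move=> v /setD1P[vu vK]; apply: xu1.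
  have xK1 : x \notin K :\ u by rewrite !inE (negbTE xK) andbF.
  have uG := subsetP KG u uK.
  have [v [vK vu yv]] : exists v, [/\ v \in K, v != u & ~~ e y v].
    (* If [u] were the only nonneighbour of [y] in [K], replacing [u] by both [x] and [y] would give
       a heavier clique: the two new weights sum to at least [n + n], which exceeds that of [u]. *)
    have [/existsP[v /and3P[]]|] := boolP [exists v, [&& v \in K, v != u & ~~ e y v]].
      by exists v.
    rewrite negb_exists => /forallP h.
    have cK2 : clique G (y |: (x |: (K :\ u))).
      apply: cliqueI => // z /setU1P[->|/setD1P[zu zK]]; first by rewrite adj_sym.
      by have := h z; rewrite zK zu negbK.
    have yK2 : y \notin x |: (K :\ u).
      rewrite !inE (negbTE yK) andbF orbF; apply: contraTneq xy => ->.
      by rewrite adj_irr.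
    have := Kmax _ cK2; rewrite /f big_setU1 //= big_setU1 //= [leqRHS](big_setD1 u) //=.
    rewrite addnA leq_add2r leqNgt (leq_trans (wt_lt _ uG)) //.
    by rewrite leq_add // leq_addr.
  (* Exchanging [u] for [x] gives a clique of the same size, so the degree of [x] cannot be larger.
     As [y] sees [x] but not [u], some [w] must see [u] but not [x]. *)
  have degle : #|[set z | e x z]| <= #|[set z | e u z]|.
    have := Kmax _ cK1; rewrite /f big_setU1 //= [leqRHS](big_setD1 u) //= leq_add2r.
    by rewrite leq_add2l.
  have [w uw xw] : exists2 w, e u w & ~~ e x w.
    have [E|/subsetPn[w]] := boolP ([set z | e u z] \subset [set z | e x z]).
      have : y \in [set z | e u z].
        suff -> : [set z | e u z] = [set z | e x z] by rewrite inE.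
        by apply/eqP; rewrite eqEcard E.
      by rewrite inE adj_sym (negbTE yu).
    by rewrite !inE; exists w.
  have vx : e v x by rewrite adj_sym xu1.
  have uv : e u v by rewrite KK // eq_sym.
  have nxw : x != w by apply: contraNneq xu => ->; rewrite adj_sym.
  have nyv : y != v by apply: contraNneq yK => ->.
  (* According to the adjacencies of [w] to [y] and [v], there is a 2K2 on [x y] and [u w], a C4 on
     [x y w v], or a C5 on [x y w u v]. *)
  have [yw|yw] := boolP (e y w); last first.
    by case: nK2; exists x, y, u, w; rewrite xy uw xu xw yu yw.
  have [vw|vw] := boolP (e v w).
    by apply: (@no_C4 x y w v) => //; rewrite adj_sym.
  by apply: nC5; apply: (@induces_pentagon _ _ x y w u v) => //; rewrite adj_sym.
have [/forall_inP h|] := boolP [forall u in K, ~~ e x0 u ==> ~~ e y0 u].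
  by apply: (main x0 y0) => // u uK; apply/implyP/h.
rewrite negb_forall_in => /exists_inP[u uK]; rewrite negb_imply negbK => /andP[xu yu].
apply: (main y0 x0) => //; first by rewrite adj_sym.
move=> v vK yv; apply/negP => xv.
have nuv : u != v by apply: contraNneq yv => <-.
apply: (@no_C4 x0 y0 u v) => //; first exact: KK.
- by rewrite adj_sym.
- by apply: contraNneq x0K => ->.
by apply: contraNneq y0K => ->.
Qed.

End Split.

(** * Free graphs containing 2K2 *)

(** With the partition given by a type function, all adjacency conditions of [divided] become one
    case analysis over [unif_table]. *)
Lemma divided_by_type (U : finType) (V : {set U}) (e : rel U) (k : U -> nat) :
  irreflexive e -> (forall z, z \in V -> k z < 5) ->
  (forall z w b, z \in V -> w \in V -> z != w ->
     unif_table (k z) (k w) = Some b -> e z w = b) ->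
  1 < #|[set z in V | k z == 0]| -> [set z in V | k z == 2] != set0 ->
  1 < #|[set z in V | (k z == 1) || (k z == 2)]| ->
  (forall z, z \in V -> k z = 3 -> exists2 a, a \in V & k a = 0 /\ ~~ e z a) ->
  divided V e.
Proof.
move=> ei k5 ktb A2 C0 BC2 L0; pose X i := [set z in V | k z == i].
have XP i z : z \in X i -> z \in V /\ k z = i by rewrite inE => /andP[-> /eqP].
have dj i j : i != j -> [disjoint X i & X j].
  move=> nij; apply/pred0P => z; rewrite /= !inE; case: (z \in V) => //=.
  by apply: contraNF nij => /andP[/eqP-> /eqP->].
have tb i j b : unif_table i j = Some b -> {in X i & X j, forall x y, x != y -> e x y = b}.
  by move=> E x y /XP[xV kx] /XP[yV ky] n; apply: ktb => //; rewrite kx ky.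
have neq i j x y : i != j -> x \in X i -> y \in X j -> x != y.
  by move=> nij xi; apply: contraTneq => <-; rewrite (disjointFr (dj _ _ nij)).
exists (X 0), (X 1), (X 2), (X 3), (X 4); split; last split.
- split => //; first by rewrite /= !dj.
    apply/setP => z; rewrite !inE; case zV: (z \in V) => //=.
    by have := k5 _ zV; case: (k z) => [|[|[|[|[|]]]]].
  rewrite (_ : X 1 :|: X 2 = [set z in V | (k z == 1) || (k z == 2)]) //.
  by apply/setP => z; rewrite !inE andb_orr.
- split=> x y hx hy.
  + exact: (@tb 3 3 true).
  + have [->|n] := eqVneq x y; first by rewrite ei.
    by rewrite (@tb 4 4 false).
  + by rewrite (@tb 0 4 false) // (@neq 0 4).
  + by rewrite (@tb 0 1 true) // (@neq 0 1).
  by rewrite (@tb 0 2 false) // (@neq 0 2).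
split=> [x y hx /setUP[] hy|x y hx hy|x /XP[xV kx]].
- by rewrite (@tb 3 1 true) // (@neq 3 1).
- by rewrite (@tb 3 2 true) // (@neq 3 2).
- by rewrite (@tb 4 2 false) // (@neq 4 2).
by have [a aV [ka na]] := L0 x xV kx; exists a; rewrite // inE aV ka.
Qed.

Lemma connect_ind (T : finType) (r : rel T) (P : pred T) x y :
  (forall u v, r u v -> P u -> P v) -> connect r x y -> P x -> P y.
Proof.
move=> h /connectP[p + ->]; elim: p x => //= z p IH x /andP[xz /IH{}IH] Px.
by apply: IH; apply: h xz Px.
Qed.

(** Applied to adjacency to a fixed vertex, this finds an edge of a connected set on which that
    vertex is mixed. *)
Lemma connect_switch (T : finType) (r : rel T) (P : pred T) x y :
  connect r x y -> P x -> ~~ P y ->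
  exists u v, [/\ connect r x u, r u v, P u & ~~ P v].
Proof.
move=> /connectP[p + ->]; elim: p x => [|z p IH] x /=; first by move=> _ ->.
case/andP=> xz zp Px Py; have [Pz|Pz] := boolP (P z); last first.
  by exists x, z; rewrite connect0.
have [u [v [zu uv Pu Pv]]] := IH z zp Pz Py.
by exists u, v; split=> //; apply: connect_trans zu; apply: connect1.
Qed.

(** * Attachments to two anticomplete sides *)

Section Core.
Variables (U : finType) (G : graph U).
Local Notation e := (adj G).
Hypothesis fG : free e.
Hypothesis nC5 : ~ induces pent_rel e.

Section Sides.
Variables A C S : {set U}.
Hypothesis hA : forall s x, s \in S -> x \in A -> ~~ e s x ->
  exists u v, [/\ u \in A, v \in A, e u v, e s u & ~~ e s v].
Hypothesis hC : forall s x, s \in S -> x \in C -> ~~ e s x ->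
  exists u v, [/\ u \in C, v \in C, e u v, e s u & ~~ e s v].
Hypothesis AC : {in A & C, forall x y, ~~ e x y}.

(** By [hA] and [hC], a vertex of [S] with a nonneighbour on a side is mixed on an edge of that
    side. Being mixed on an edge of each side, it would be the middle of an induced P5. *)
Lemma not_mixed_both s x y : s \in S -> x \in A -> y \in C -> ~~ e s x -> e s y.
Proof.
move=> sS xA yC sx; apply: contraT => sy.
have [u [v [uA vA uv su sv]]] := hA sS xA sx.
have [u' [v' [uC vC uv' su' sv']]] := hC sS yC sy.
case: fG => h _; case: h; apply: (@induces_path _ _ v u s u' v') => //;
  by rewrite adj_sym // adj_sym AC.
Qed.

(** Each of [s] and [t] is complete to the side where the other is mixed. If they were nonadjacent,
    then with [b] a neighbour of [s] in [A] and [u v] an edge of [C] on which [t] is mixed, the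
    cycle [s u t b] with roof [v] would be a house. *)
Lemma mixed_left_right s t a c : s \in S -> t \in S -> a \in A -> c \in C ->
  ~~ e s a -> ~~ e t c -> e s t.
Proof.
move=> sS tS aA cC sa tc; apply: contraT => st.
have [u [v [uC vC uv tu tv]]] := hC tS cC tc.
have [b [_ [bA _ _ sb _]]] := hA sS aA sa.
have sC y : y \in C -> e s y by move=> yC; apply: not_mixed_both sa.
have tA : e t b by apply: contraT => tb; rewrite (not_mixed_both tS bA cC tb) in tc.
case: fG => _ h; case: h; apply: (@induces_house _ _ s u t b v) => //.
- exact: sC.
- by rewrite adj_sym.
- by rewrite adj_sym.
- by rewrite adj_sym AC.
- by rewrite adj_sym sC.
- by rewrite adj_sym.
- by rewrite adj_sym.
by rewrite adj_sym AC.
Qed.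

Lemma nonadjacent_same_nbrs y c x x' a : y \in S -> c \in C -> ~~ e y c ->
  x \in S -> x' \in S -> ~~ e x x' -> a \in A -> e x a -> e x' a.
Proof.
move=> yS cC yc xS x'S xx' aA xa; apply: contraT => x'a.
have x'c : e x' c by apply: not_mixed_both x'a.
have ya : e y a by apply: contraT => na; rewrite (not_mixed_both yS aA cC na) in yc.
have x'y : e x' y by apply: (mixed_left_right x'S yS aA cC).
have xc : e x c.
  by apply: contraT => xc; move: xx'; rewrite adj_sym (mixed_left_right x'S xS aA cC x'a xc).
have ac := AC aA cC; case: fG => _ h.
(* If [x] and [y] are adjacent, the cycle [y x c x'] with roof [a] is a house; if not, [x a y x' c]
   is a pentagon. *)
have [xy|xy] := boolP (e x y).
  case: h; apply: (@induces_house _ _ y x c x' a) => //; rewrite 1?adj_sym //.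
by case: nC5; apply: (@induces_pentagon _ _ x a y x' c) => //; rewrite 1?adj_sym.
Qed.

End Sides.

Section Partition.
Hypothesis pG : prime_graph G.
Variables A C S T : {set U}.
Hypothesis GV : vertices G = A :|: C :|: S :|: T.
Hypothesis dis : pairwise (fun X Y : {set U} => [disjoint X & Y]) [:: A; C; S; T].
Hypothesis A2 : 1 < #|A|.
Hypothesis C2 : 1 < #|C|.
Hypothesis hA : forall s x, s \in S -> x \in A -> ~~ e s x ->
  exists u v, [/\ u \in A, v \in A, e u v, e s u & ~~ e s v].
Hypothesis hC : forall s x, s \in S -> x \in C -> ~~ e s x ->
  exists u v, [/\ u \in C, v \in C, e u v, e s u & ~~ e s v].
Hypothesis AC : {in A & C, forall x y, ~~ e x y}.
Hypothesis TAC : {in T & A :|: C, forall x y, ~~ e x y}.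
Hypothesis TT : {in T &, forall x y, ~~ e x y}.

Let dAC : [disjoint A & C]. Proof. by move: dis => /= /and4P[/and4P[]]. Qed.
Let dAS : [disjoint A & S]. Proof. by move: dis => /= /and4P[/and4P[]]. Qed.
Let dAT : [disjoint A & T]. Proof. by move: dis => /= /and4P[/and4P[]]. Qed.
Let dCS : [disjoint C & S]. Proof. by move: dis => /= /and4P[_ /and3P[]]. Qed.
Let dCT : [disjoint C & T]. Proof. by move: dis => /= /and4P[_ /and3P[]]. Qed.

(** Otherwise [X] is homogeneous: vertices of [S] are complete to it and the other outside vertices
    anticomplete to it. *)
Lemma prime_mixed (X : {set U}) : X \subset vertices G -> 1 < #|X| -> #|X| < #|vertices G| ->
  (forall v, v \in vertices G -> v \notin X -> v \notin S -> forall x, x \in X -> ~~ e v x) ->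
  exists s x, [/\ s \in S, x \in X & ~~ e s x].
Proof.
move=> XG X2 Xlt hX.
have [/existsP[s /existsP[x /and3P[]]]|] :=
  boolP [exists s, exists x, [&& s \in S, x \in X & ~~ e s x]]; first by exists s, x.
rewrite negb_exists => /forallP h; case: (pG (X := X)); split=> // v x y.
case/setDP=> vG vX xX yX; have [vS|vS] := boolP (v \in S); last first.
  by rewrite (negbTE (hX v vG vX vS x xX)) (negbTE (hX v vG vX vS y yX)).
have c z : z \in X -> e v z.
  move=> zX; have := h v; rewrite negb_exists => /forallP/(_ z).
  by rewrite vS zX negbK.
by rewrite !c.
Qed.

Let AG : A \subset vertices G. Proof. by rewrite GV -!setUA subsetUl. Qed.
Let CG : C \subset vertices G.
Proof. by rewrite GV -!setUA (subset_trans _ (subsetUr _ _)) ?subsetUl. Qed.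
Let SG : S \subset vertices G. Proof. by rewrite GV setUAC subsetUr. Qed.

Lemma mixed_on_A : exists s x, [/\ s \in S, x \in A & ~~ e s x].
Proof.
apply: prime_mixed => //.
  apply: proper_card; apply/properP; split=> //.
  have /card_gt0P[c cC] : 0 < #|C| by apply: ltnW.
  by exists c; rewrite ?(subsetP CG) // (disjointFl dAC).
move=> v; rewrite GV !in_setU => /orP[/orP[/orP[->//|vC]|->//]|vT] _ _ x xA.
  by rewrite adj_sym AC.
by rewrite TAC // inE xA.
Qed.

Lemma mixed_on_C : exists s x, [/\ s \in S, x \in C & ~~ e s x].
Proof.
apply: prime_mixed => //.
  apply: proper_card; apply/properP; split=> //.
  have /card_gt0P[c cA] : 0 < #|A| by apply: ltnW.
  by exists c; rewrite ?(subsetP AG) // (disjointFr dAC).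
move=> v; rewrite GV !in_setU => /orP[/orP[/orP[vA|->//]|->//]|vT] _ _ x xC.
  by rewrite AC.
by rewrite TAC // inE xC orbT.
Qed.

(** By primality each side has a vertex of [S] mixed on it, so [nonadjacent_same_nbrs] applies to
    either side, with the roles of [A] and [C] exchanged for the second. *)
Lemma same_nbrs x x' a : x \in S -> x' \in S -> ~~ e x x' -> a \in A :|: C ->
  e x a = e x' a.
Proof.
have K x1 x2 : x1 \in S -> x2 \in S -> ~~ e x1 x2 -> a \in A :|: C -> e x1 a -> e x2 a.
  move=> x1S x2S n /setUP[aA|aC].
    have [y [c [yS cC yc]]] := mixed_on_C.
    exact: (nonadjacent_same_nbrs hA hC AC yS cC yc).
  have [y [c [yS cA yc]]] := mixed_on_A.
  have CA : {in C & A, forall x y, ~~ e x y} by move=> u v uC vA; rewrite adj_sym AC.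
  exact: (nonadjacent_same_nbrs hC hA CA yS cA yc).
move=> xS x'S n aAC; apply/idP/idP; apply: K => //.
by rewrite adj_sym.
Qed.

Lemma divided_of_clique : {in S &, forall x y, x != y -> e x y} ->
  divided (vertices G) e.
Proof.
(* The clique [S] splits into L, the vertices with a nonneighbour in [A], and B, those complete to
   [A]. By [not_mixed_both] the former are complete to [C]. *)
move=> SS; pose k z := if z \in A then 0 else if z \in C then 2 else if z \in T then 4
  else if [exists x in A, ~~ e z x] then 3 else 1.
have k0 z : k z = 0 -> z \in A by rewrite /k; do 4?case: ifP.
have k2 z : k z = 2 -> z \in C by rewrite /k; do 4?case: ifP.
have k4 z : k z = 4 -> z \in T by rewrite /k; do 4?case: ifP.
have kS z : z \in vertices G -> (k z == 3) || (k z == 1) -> z \in S.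
  by rewrite GV !inE /k; do 4?case: ifP; rewrite ?orbF.
have k3 z : k z = 3 -> exists2 x, x \in A & ~~ e z x.
  by rewrite /k; do 3?case: ifP => //; case: ifP => // /exists_inP[x]; exists x.
have k1 z x : k z = 1 -> x \in A -> e z x.
  rewrite /k; do 3?case: ifP => //; case: ifP => // /negbT; rewrite negb_exists_in.
  by move=> /forall_inP h _ _ _ _ /h; rewrite negbK.
have kA z : z \in A -> k z = 0 by rewrite /k => ->.
have kC z : z \in C -> k z = 2 by rewrite /k => zC; rewrite (disjointFl dAC) // zC.
apply: (@divided_by_type _ _ _ k).
- exact: adj_irr.
- by move=> z _; rewrite /k; do 4?case: ifP.
- have main z w b : z \in vertices G -> w \in vertices G -> z != w ->
    k z <= k w -> unif_table (k z) (k w) = Some b -> e z w = b.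
    move=> zG wG n; case kz: (k z) => [|[|[|[|[|]]]]] //; case kw: (k w) => [|[|[|[|[|]]]]] //= _ [<-].
    + by rewrite adj_sym (k1 w) // k0.
    + by apply/negbTE/AC; [apply: k0 | apply: k2].
    + by apply/negbTE; rewrite adj_sym TAC // ?k4 // inE k0.
    + by rewrite SS // kS // ?kz ?kw.
    + have [x xA wx] := k3 _ kw; rewrite adj_sym.
      by apply: (not_mixed_both hA hC AC _ xA _ wx); [apply: kS; rewrite ?kw | apply: k2].
    + by apply/negbTE; rewrite adj_sym TAC // ?k4 // inE k2 ?orbT.
    + by rewrite SS // kS // ?kz ?kw.
    by apply/negbTE/TT; apply: k4.
  move=> z w b zG wG n E; have [l|l] := leqP (k z) (k w); first exact: main E.
  rewrite adj_sym; apply: main (ltnW l) _ => //; first by rewrite eq_sym.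
  move: E; case: (k z) => [|[|[|[|[|]]]]] //; case: (k w) => [|[|[|[|[|]]]]] //.
- apply: leq_trans A2 _; apply/subset_leq_card/subsetP => z zA.
  by rewrite inE kA // (subsetP AG).
- have /card_gt0P[c cC] : 0 < #|C| by apply: ltnW.
  by apply/set0Pn; exists c; rewrite inE kC // (subsetP CG).
- apply: leq_trans C2 _; apply/subset_leq_card/subsetP => z zC.
  by rewrite inE kC // (subsetP CG).
move=> z zG /k3[x xA zx]; exists x; first exact: (subsetP AG).
by rewrite kA.
Qed.

(* The connected components of this relation are the anticomponents of S. *)
Let rS : rel U := fun x y => [&& x \in S, y \in S, x != y & ~~ e x y].
Let H x := [set y | connect rS x y].
Let Tc x := [set t in T | [forall y in H x, e t y]].

Let rS_sym : symmetric rS.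
Proof. by move=> x y; rewrite /rS andbCA eq_sym adj_sym. Qed.

Lemma divided_of_nonclique x0 y0 : rS x0 y0 ->
  divided (vertices G) (adj (compl_graph G)).
Proof.
move=> xy0; pose nt x := [exists y, rS x y].
have nt0 : nt x0 by apply/existsP; exists y0.
(* [nt x] says that the anticomponent of [x] has at least two vertices. *)
have [x /existsP[x' xx'] xmax] : exists2 x, nt x & forall y, nt y -> #|Tc y| <= #|Tc x|.
  by case: (@arg_maxnP _ x0 nt (fun x => #|Tc x|) nt0) => x; exists x.
have csym := sym_connect_sym rS_sym.
have xS : x \in S by case/and4P: xx'.
have HS y : y \in H x -> y \in S.
  rewrite inE => xy; move: xS; apply: (@connect_ind _ rS (mem S)) xy => u v /and4P[_ ? _ _] _ //.
have xH : x \in H x by rewrite inE connect0.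
have HSc y z : y \in H x -> z \in S -> z \notin H x -> e y z.
  move=> yH zS zH; apply: contraNT zH => yz; have [->//|n] := eqVneq z y.
  have yS := HS y yH; move: yH; rewrite !inE => /connect_trans; apply; apply: connect1.
  by rewrite /rS yS zS yz eq_sym n.
have HN y a : y \in H x -> a \in A :|: C -> e y a = e x a.
  move=> yH aAC; apply/eqP; move: yH (eqxx (e x a)); rewrite inE.
  apply: (@connect_ind _ rS (fun y => e y a == e x a)) => u v /and4P[uS vS _ uv] /eqP <-.
  by rewrite (same_nbrs uS vS uv).
pose Tm := [set t in T | [exists y in H x, e t y] && [exists y in H x, ~~ e t y]].
(* A vertex mixed on an anticomponent is mixed on some nonadjacent pair of it. *)
have sw t : t \in Tm -> exists y y', [/\ y \in H x, y' \in H x, ~~ e y y', e t y & ~~ e t y'].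
  rewrite inE => /and3P[tT /exists_inP[y yH ty] /exists_inP[z zH tz]].
  have yz : connect rS y z.
    by move: yH zH; rewrite !inE csym => /connect_trans; apply.
  have [u [v [yu uv tu tv]]] := connect_switch yz ty tz.
  have uH : u \in H x by move: yH; rewrite !inE => /connect_trans; apply.
  exists u, v; split=> //; last by case/and4P: uv.
  by move: uH; rewrite !inE => /connect_trans; apply; apply: connect1.
pose Z := [set z in S :\: H x | [exists t in Tm, e t z]].
have ZP z : z \in Z -> [/\ z \in S, z \notin H x & exists2 t, t \in Tm & e t z].
  by rewrite !inE => /andP[/andP[? ?] /exists_inP[t tT tz]]; split=> //; exists t.
(* With [y y'] a nonadjacent pair of [H x] on which [t] is mixed, nonadjacent [z] and [w] would give
   the cycle [y z y' w] with roof [t], a house. *)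
have house t z w : t \in Tm -> z \in S -> z \notin H x -> e t z ->
    (forall y, y \in H x -> e y w) -> ~~ e t w -> e z w.
  move=> tT zS zH tz Hw tw; apply: contraT => zw.
  have [y [y' [yH yH' yy' ty ty']]] := sw t tT.
  case: fG => _ h; case: h; apply: (@induces_house _ _ y z y' w t) => //.
  - exact: HSc.
  - by rewrite adj_sym; apply: HSc.
  - exact: Hw.
  by rewrite adj_sym; apply: Hw.
have TmT t : t \in Tm -> t \in T by rewrite inE => /andP[].
have ZN z a : z \in Z -> a \in A :|: C -> e x a -> e z a.
  move=> /ZP[zS zH [t tT tz]] aAC xa; apply: (house t) => //; last by apply: TAC => //; apply: TmT.
  by move=> y yH; rewrite HN.
have ZT z s : z \in Z -> s \in T -> (forall y, y \in H x -> e s y) -> e z s.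
  move=> /ZP[zS zH [t tT tz]] sT sH; apply: (house t) => //; last by apply: TT => //; apply: TmT.
  by move=> y yH; rewrite adj_sym sH.
have ZW z w : z \in Z -> w \in S -> w \notin H x -> w \notin Z -> e z w.
  move=> /ZP[zS zH [t tT tz]] wS wH wZ; apply: (house t) => //.
    by move=> y yH; apply: HSc.
  by apply: contra wZ => tw; rewrite in_set in_setD wS wH /=; apply/exists_inP; exists t.
(* Otherwise the anticomponent of z contradicts the choice of x. *)
have ZZ z z' : z \in Z -> z' \in Z -> z != z' -> e z z'.
  move=> zZ zZ' n; apply: contraT => zz'.
  have [zS zH [t tT tz]] := ZP _ zZ; have [zS' _ _] := ZP _ zZ'.
  have ntz : nt z by apply/existsP; exists z'; rewrite /rS zS zS' n zz'.
  (* The anticomponent of [z] stays within [Z] and within the neighbours of [t]. By [ZT] it follows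
     that [Tc z] contains [Tc x], and it also contains [t], which is mixed on [H x]. *)
  have HZ y : y \in H z -> (y \in Z) && e t y.
    rewrite inE => zy; have : (z \in Z) && e t z by rewrite zZ tz.
    apply: (@connect_ind _ rS (fun y => (y \in Z) && e t y)) zy => u v /and4P[uS vS uv nuv] /andP[uZ tu].
    have [_ uH _] := ZP _ uZ.
    have vH : v \notin H x.
      by apply: contra nuv => vH; rewrite adj_sym HSc.
    have vZ : v \in Z by apply: contraT => vZ; rewrite (ZW u v) in nuv.
    rewrite vZ; apply: contraNT nuv => tv; apply: (house t) => //.
    by move=> y1 y1H; apply: HSc.
  have := xmax z ntz; rewrite leqNgt => /negP[]; apply: proper_card; apply/properP; split.
    apply/subsetP => s; rewrite [s \in Tc x]inE => /andP[sT /forall_inP sH].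
    rewrite inE sT; apply/forall_inP => y /HZ/andP[yZ _].
    by rewrite adj_sym ZT.
  exists t.
    by rewrite inE TmT //; apply/forall_inP => y /HZ/andP[].
  rewrite inE TmT //=; apply/forall_inP => h.
  by have [_ [y [_ yH _ _ /negP[]]]] := sw t tT; apply: h.
(* Types are meant in the complement: A is [H x], L is [Tm] and T is [Z]. Of the other vertices,
   those anticomplete to [H x] in [G] form B and those complete to it form C. *)
pose k z := if z \in H x then 0 else if z \in S then (if z \in Z then 4 else 2)
  else if z \in T then (if z \in Tm then 3 else if z \in Tc x then 2 else 1)
  else if e x z then 2 else 1.
have k0 z : k z = 0 -> z \in H x by rewrite /k; do 6?case: ifP.
have k3 z : k z = 3 -> z \in Tm by rewrite /k; do 6?case: ifP.
have k4 z : k z = 4 -> z \in Z by rewrite /k; do 6?case: ifP.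
have VAC z : z \in vertices G -> z \notin S -> z \notin T -> z \in A :|: C.
  by rewrite GV !inE => /orP[/orP[|->]|->].
have k1 z : z \in vertices G -> k z = 1 ->
    (z \in T :|: (A :|: C)) /\ forall y, y \in H x -> ~~ e y z.
  move=> zG; rewrite /k in_setU; case: ifP => // zH; case: (boolP (z \in S)) => zS; first by case: ifP.
  case: (boolP (z \in T)) => zT.
    case: ifP => // zm; case: ifP => // zc _; split=> // y yH; rewrite adj_sym.
    move: zm zc; rewrite !in_set zT /= => zm /negbT; rewrite negb_forall_in => zc.
    by move/negbT: zm; rewrite zc andbT negb_exists_in => /forall_inP; apply.
  have zAC := VAC z zG zS zT; case: ifP => // xz _; split=> // y yH.
  by rewrite HN // xz.
have k2 z : z \in vertices G -> k z = 2 -> (forall y, y \in H x -> e y z) /\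
    [|| z \in (A :|: C), z \in T | (z \in S) && (z \notin Z)] /\ (forall w, w \in Z -> e w z).
  move=> zG; rewrite /k; case: ifP => // /negbT zH; case: (boolP (z \in S)) => zS.
    case: ifP => // /negbT zZ _; split=> [y yH|]; first by apply: HSc.
    by split=> [|w wZ]; [rewrite !orbT | apply: ZW].
  case: (boolP (z \in T)) => zT.
    case: ifP => // zm; case: ifP => // + _; rewrite inE zT => /forall_inP h.
    split=> [y yH|]; first by rewrite adj_sym h.
    by split=> [|w wZ]; [rewrite orbT | apply: ZT].
  have zAC := VAC z zG zS zT; case: ifP => // xz _; split=> [y yH|]; first by rewrite HN.
  by split=> [|w wZ]; [rewrite zAC | apply: ZN].
have TmW t z : t \in Tm -> z \in S -> z \notin H x -> z \notin Z -> ~~ e t z.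
  move=> tT zS zH; apply: contra => tz; rewrite in_set in_setD zS zH /=.
  by apply/exists_inP; exists t.
have ACk z : z \in A :|: C -> (k z == 1) || (k z == 2).
  move=> zAC; have zS : z \notin S.
    by case/setUP: zAC => h; apply/negbT; [apply: disjointFr dAS h | apply: disjointFr dCS h].
  have zT : (z \in T) = false.
    by case/setUP: zAC => h; [apply: disjointFr dAT h | apply: disjointFr dCT h].
  rewrite /k zT (negbTE zS) ifN; first by case: ifP.
  by apply: contra zS; apply: HS.
have ACG z : z \in A :|: C -> z \in vertices G.
  by case/setUP => h; [apply: (subsetP AG) | apply: (subsetP CG)].
have HG z : z \in H x -> z \in vertices G by move=> /HS; apply: (subsetP SG).
have kH z : z \in H x -> k z = 0 by rewrite /k => ->.
apply: (@divided_by_type _ _ _ k).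
- exact: adj_irr.
- by move=> z _; rewrite /k; do 6?case: ifP.
(* This is stated in [G], hence with [~~ b]; by symmetry of the table it suffices to treat
   [k z <= k w]. *)
- have main z w b : z \in vertices G -> w \in vertices G -> z != w ->
    k z <= k w -> unif_table (k z) (k w) = Some b -> e z w = ~~ b.
    move=> zG wG n; case kz: (k z) => [|[|[|[|[|]]]]] //; case kw: (k w) => [|[|[|[|[|]]]]] //= _ [<-].
    + by have [_ h] := k1 w wG kw; apply/negbTE/h/k0.
    + by have [h _] := k2 w wG kw; apply/h/k0.
    + by have [wS wH _] := ZP _ (k4 _ kw); apply: HSc => //; apply: k0.
    + have [h _] := k1 z zG kz; rewrite adj_sym; apply/negbTE.
      by case/setUP: h => h; [apply: TT | apply: TAC] => //; apply/TmT/k3.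
    + have [_ [h _]] := k2 z zG kz; rewrite adj_sym; apply/negbTE.
      have zH : z \notin H x by apply: contraPN kz => /kH ->.
      have wm := k3 _ kw; case/or3P: h => [h|h|/andP[zS zZ]].
      * by apply: TAC => //; apply: TmT.
      * by apply: TT => //; apply: TmT.
      exact: TmW.
    + by have [_ [_ h]] := k2 z zG kz; rewrite adj_sym; apply/h/k4.
    + by apply/negbTE/TT; apply/TmT/k3.
    by apply: ZZ => //; apply: k4.
  move=> z w b zG wG n E; rewrite adj_compl zG wG n /=.
  have [l|l] := leqP (k z) (k w); first by rewrite (main z w b) // negbK.
  rewrite adj_sym (main w z b) ?negbK // 1?eq_sym // 1?ltnW //.
  by move: E; case: (k z) => [|[|[|[|[|]]]]] //; case: (k w) => [|[|[|[|[|]]]]].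
- apply/card_gt1P; exists x, x'; have [_ _ n _] := and4P xx'.
  have xH' : x' \in H x by rewrite inE connect1.
  by rewrite !in_set !kH ?HG.
- have /card_gt0P[c cC] : 0 < #|C| by apply: ltnW.
  have /card_gt0P[a aA] : 0 < #|A| by apply: ltnW.
  (* Since [x] cannot have nonneighbours on both sides, it sees some [u], whose type is then 2. *)
  have [u uAC xu] : exists2 u, u \in A :|: C & e x u.
    have [xa|xa] := boolP (e x a); first by exists a; rewrite // inE aA.
    exists c; first by rewrite inE cC orbT.
    exact: (not_mixed_both hA hC AC xS aA cC xa).
  apply/set0Pn; exists u; rewrite in_set ACG //.
  case/orP: (ACk u uAC) => [/eqP ku|->//].
  by have [_ h] := k1 u (ACG u uAC) ku; have := h x xH; rewrite xu.
- apply: leq_trans A2 _; apply/subset_leq_card/subsetP => z zA.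
  by have zAC : z \in A :|: C; rewrite inE ?zA // ACG ?ACk.
move=> z zG /k3 zm; have [y [_ [yH _ _ zy _]]] := sw z zm.
exists y; first exact: HG.
by rewrite kH // adj_compl zy !andbF.
Qed.

Lemma divided_of_partition :
  divided (vertices G) e \/ divided (vertices G) (adj (compl_graph G)).
Proof.
have [/existsP[x /existsP[y xy]]|] := boolP [exists x, exists y, rS x y].
  by right; apply: divided_of_nonclique xy.
rewrite negb_exists => /forallP h; left; apply: divided_of_clique => x y xS yS n.
by have := h x; rewrite negb_exists => /forallP/(_ y); rewrite /rS xS yS n /= negbK.
Qed.

End Partition.

(* X is a largest set inducing a graph with two nontrivial components. *)
Lemma divided_of_2K2 : prime_graph G -> has_2K2 G ->
  divided (vertices G) e \/ divided (vertices G) (adj (compl_graph G)).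
Proof.
move=> pG [a0 [b0 [c0 [d0 /and5P[ab0 cd0 ac0 ad0 /andP[bc0 bd0]]]]]].
pose r X := adj (induced G X).
have rE X x y : r X x y = [&& x \in X, y \in X & e x y] by apply: adj_induced.
have rs X : connect_sym (r X) by apply/sym_connect_sym/adj_sym.
(* Two edges in different components witness two nontrivial components. *)
pose good (X : {set U}) := (X \subset vertices G) && [exists a, exists b, exists c, exists d,
  [&& r X a b, r X c d & ~~ connect (r X) a c]].
have goodI (X : {set U}) a b c d : X \subset vertices G -> r X a b -> r X c d ->
    ~~ connect (r X) a c -> good X.
  move=> XG ab cd ac; rewrite /good XG; apply/existsP; exists a; apply/existsP; exists b.
  by apply/existsP; exists c; apply/existsP; exists d; rewrite ab cd ac.
pose X0 := [set a0; b0; c0; d0].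
have good0 : good X0.
  apply: (@goodI _ a0 b0 c0 d0).
  - apply/subsetP => x; rewrite !inE -!orbA => /or4P[]/eqP->.
    + exact: adj_vertices ab0.
    + exact: adj_verticesr ab0.
    + exact: adj_vertices cd0.
    exact: adj_verticesr cd0.
  - by rewrite rE !inE !eqxx ab0 ?orbT.
  - by rewrite rE !inE !eqxx cd0 ?orbT.
  apply/negP => /(@connect_ind _ _ (mem [set a0; b0])) h.
  have : c0 \in [set a0; b0].
    apply: h; last by rewrite /= set21.
    move=> u v; rewrite rE /= => /and3P[_ vX uv] /set2P[] E; move: vX uv; rewrite E !inE -!orbA;
      move=> /or4P[]/eqP-> //; rewrite ?eqxx ?orbT //.
    + by rewrite (negbTE ac0).
    + by rewrite (negbTE ad0).
    + by rewrite (negbTE bc0).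
    by rewrite (negbTE bd0).
  by case/set2P => E; move: cd0; rewrite E ?(negbTE ad0) ?(negbTE bd0).
have [X /andP[XG gX] Xmax] : exists2 X, good X & forall Y, good Y -> #|Y| <= #|X|.
  by case: (@arg_maxnP _ X0 good (fun X => #|X|) good0) => X; exists X.
have [a [b [c [d [ab cd ac]]]]] : exists a b c d, [/\ r X a b, r X c d & ~~ connect (r X) a c].
  by move: gX => /existsP[a /existsP[b /existsP[c /existsP[d /and3P[]]]]]; exists a, b, c, d.
have cX x y : x \in X -> connect (r X) x y -> y \in X.
  move=> xX xy; move: xX; apply: (@connect_ind _ (r X) (mem X)) xy => u v.
  by rewrite rE /= => /and3P[].
(* If [s] had no neighbour in the component of [x], this component would survive in [s |: X] next to
   another nontrivial one, against the maximality of [X]. Otherwise [s] is mixed on the component,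
   hence on an edge of it. *)
have key s x y : s \in vertices G -> s \notin X -> r X x y -> ~~ e s x ->
    exists u v, [/\ connect (r X) x u, r X u v, e s u & ~~ e s v].
  move=> sG sX xy sx; have xX : x \in X by move: xy; rewrite rE => /and3P[].
  have [/existsP[u /andP[xu su]]|] := boolP [exists u, connect (r X) x u && e s u].
    have ux : connect (r X) u x by rewrite rs.
    have [v [w [uv vw sv sw]]] := connect_switch ux su sx.
    by exists v, w; split=> //; apply: connect_trans uv.
  rewrite negb_exists => /forallP h.
  have [p [q [pq xp]]] : exists p q, r X p q /\ ~~ connect (r X) x p.
    have [xa|xa] := boolP (connect (r X) x a); last by exists a, b.
    exists c, d; split=> //; apply: contra ac => xc.
    by apply: connect_trans xc; rewrite rs.
  have mono u v : r X u v -> r (s |: X) u v.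
    by rewrite !rE => /and3P[uX vX ->]; rewrite !inE uX vX !orbT.
  have : good (s |: X).
    apply: (@goodI _ x y p q); rewrite ?mono //; first by rewrite subUset sub1set sG.
    apply: contra xp => /(@connect_ind _ _ (connect (r X) x)); apply; last exact: connect0.
    move=> u v; rewrite rE => /and3P[_ /setU1P[->|vX] uv] xu.
      by have := h u; rewrite xu adj_sym uv.
    have uX := cX x u xX xu; apply: connect_trans xu _; apply: connect1.
    by rewrite rE uX vX uv.
  by move/Xmax; rewrite cardsU1 sX ltnn.
(* [C] may consist of several components; [key] still gives the hypothesis for it, as the edge it
   finds lies in the component of the given vertex. *)
pose A := [set x | connect (r X) a x].
pose T := [set x in X | ~~ [exists y, r X x y]].
pose C := X :\: A :\: T.
have aX : a \in X by move: ab; rewrite rE => /and3P[].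
have bX : b \in X by move: ab; rewrite rE => /and3P[].
have AX x : x \in A -> x \in X by rewrite inE; apply: cX.
have niA x : x \in A -> exists y, r X x y.
  rewrite inE rs => /connectP[[|y p] /= + E]; first by move=> _; exists b; rewrite -E.
  by case/andP => xy _; exists y.
have Acl x y : x \in A -> r X x y -> y \in A.
  by rewrite !inE => xA /connect1; apply: connect_trans.
have CP x : x \in C -> [/\ x \in X, x \notin A & exists y, r X x y].
  by case/setDP => /setDP[xX xA]; rewrite inE xX negbK => /existsP.
have CI x y : x \in X -> x \notin A -> r X x y -> x \in C.
  move=> xX xA xy; rewrite !in_setD xX xA !andbT inE xX negbK.
  by apply/existsP; exists y.
have cC : c \in C.
  by apply: (CI c d) => //; [move: cd; rewrite rE => /and3P[] | rewrite inE].
have dC : d \in C.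
  have [cX' cA _] := CP _ cC; have dX : d \in X by move: cd; rewrite rE => /and3P[].
  have dc : r X d c by rewrite /r adj_sym.
  by apply: (CI d c) => //; apply: contra cA => dA; apply: Acl dc.
apply: (@divided_of_partition pG A C (vertices G :\: X) T).
- apply/setP => x; rewrite /C !in_setU !in_setD.
  have [xX|xX] := boolP (x \in X).
    rewrite (subsetP XG) //=; case: (boolP (x \in A)) => //= _.
    by case: (boolP (x \in T)).
  have -> : (x \in A) = false by apply: contraNF xX; apply: AX.
  have -> : (x \in T) = false by rewrite inE (negbTE xX).
  by rewrite ?andbF ?andbT ?orbF.
- have TX x : x \in T -> x \in X by rewrite inE => /andP[].
  have D (Y Z : {set U}) : (forall x, x \in Y -> x \in Z -> False) -> [disjoint Y & Z].
    by move=> h; apply/pred0P => x; apply/negP => /andP[/h].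
  rewrite /= !andbT; apply/and3P; split; [apply/and3P; split | apply/andP; split | ]; apply: D => x.
  + by move=> xA /CP[_ /negP].
  + by move=> /AX xX /setDP[_ /negP].
  + by move=> /niA[y xy]; rewrite inE => /andP[_ /existsP[]]; exists y.
  + by move=> /CP[xX _ _] /setDP[_ /negP].
  + by case/setDP => _ /negP.
  by move=> /setDP[_ /negP xX] /TX.
- apply/card_gt1P; exists a, b; split; first by rewrite inE connect0.
    by rewrite inE connect1.
  by apply: contraTneq ab => ->; rewrite /r adj_irr.
- apply/card_gt1P; exists c, d; split=> //.
  by apply: contraTneq cd => ->; rewrite /r adj_irr.
- move=> s x /setDP[sG sX] xA sx; have [y xy] := niA x xA.
  have [u [v [xu uv su sv]]] := key s x y sG sX xy sx.
  have uA : u \in A by move: xA; rewrite !inE => /connect_trans; apply.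
  exists u, v; split=> //; first exact: Acl uv.
  by move: uv; rewrite rE => /and3P[].
- move=> s x /setDP[sG sX] xC sx; have [xX xA [y xy]] := CP x xC.
  have [u [v [xu uv su sv]]] := key s x y sG sX xy sx.
  have uA : u \notin A.
    apply: contra xA; rewrite !inE => /connect_trans; apply.
    by rewrite rs.
  have [uX vX euv] : [/\ u \in X, v \in X & e u v] by move: uv; rewrite rE => /and3P[].
  have vu : r X v u by rewrite /r adj_sym.
  exists u, v; split=> //; first exact: CI uv.
  by apply: (CI v u) => //; apply: contra uA => vA; apply: Acl vu.
- move=> x y xA /CP[yX yA _]; apply: contra yA => xy; apply: (Acl x) => //.
  by rewrite rE yX xy AX.
- move=> t y; rewrite inE => /andP[tX]; rewrite negb_exists => /forallP h yAC.
  have yX : y \in X by case/setUP: yAC => [/AX|/CP[]].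
  by have := h y; rewrite rE tX yX.
move=> t y; rewrite inE => /andP[tX]; rewrite negb_exists => /forallP h.
rewrite inE => /andP[yX _].
by have := h y; rewrite rE tX yX.
Qed.

End Core.

(** * The characterization *)

Section Decidability.
Variables (U : finType) (G : graph U).
Local Notation e := (adj G).

Lemma homogeneous_or_prime :
  (exists X, homogeneous (vertices G) X e) \/ prime_graph G.
Proof.
pose hom (X : {set U}) := [&& X \subset vertices G, 1 < #|X|, #|X| < #|vertices G|
  & [forall v in vertices G :\: X, forall x in X, forall y in X, e v x == e v y]].
have [/existsP[X /and4P[XG X2 XV /forall_inP h]]|] := boolP [exists X, hom X].
  left; exists X; split=> // v x y vG xX yX; apply/eqP.
  by move/forall_inP: (h v vG) => /(_ x xX)/forall_inP; apply.
rewrite negb_exists => /forallP n; right => X [XG X2 XV h].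
case/negP: (n X); rewrite /hom XG X2 XV; apply/forall_inP => v vG.
by apply/forall_inP => x xX; apply/forall_inP => y yX; apply/eqP/h.
Qed.

Lemma induces_dec (M : rel nat) : induces M e \/ ~ induces M e.
Proof.
have [/existsP[v /forallP h]|n] :=
  boolP [exists v : {ffun 'I_5 -> U}, forall i, forall j, e (v i) (v j) == M i j].
  left; exists (fun i => v (inord i)) => i j i5 j5.
  by have /forallP/(_ (inord j))/eqP -> := h (inord i); rewrite !inordK.
right=> -[v hv]; case/existsP: n; exists [ffun i : 'I_5 => v i].
by apply/forallP => i; apply/forallP => j; rewrite !ffunE; apply/eqP/hv.
Qed.

Lemma has_2K2_dec : has_2K2 G \/ ~ has_2K2 G.
Proof.
have [/existsP[a /existsP[b /existsP[c /existsP[d h]]]]|n] := boolP [exists a, exists b,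
  exists c, exists d, [&& e a b, e c d, ~~ e a c, ~~ e a d, ~~ e b c & ~~ e b d]].
  by left; exists a, b, c, d.
right=> -[a [b [c [d h]]]]; case/negP: n; apply/existsP; exists a; apply/existsP; exists b.
by apply/existsP; exists c; apply/existsP; exists d.
Qed.

End Decidability.

Lemma prime_compl (U : finType) (G : graph U) : prime_graph G -> prime_graph (compl_graph G).
Proof.
move=> pG X [XG X2 XV h]; apply: (pG X); split=> // v x y vX xX yX.
have := h v x y vX xX yX; rewrite !adj_compl; case/setDP: (vX) => vG vnX.
have nv z : z \in X -> v != z by apply: contraTneq => <-.
by rewrite vG !nv // !(subsetP XG) //= => /negb_inj.
Qed.

(* The complement of the cycle 0 1 2 3 4 is the cycle 0 2 4 1 3. *)
Lemma induces_pent_compl (U : finType) (G : graph U) :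
  induces pent_rel (adj (compl_graph G)) -> induces pent_rel (adj G).
Proof.
case=> v hv; have tc : twin_free pent_rel by [].
exists (fun i => v (i.*2 %% 5)) => i j i5 j5.
have m k : k.*2 %% 5 < 5 by rewrite ltn_mod.
have [Eij|nij] := eqVneq (i.*2 %% 5) (j.*2 %% 5).
  rewrite Eij adj_irr; move: Eij i5 j5.
  by case: i => [|[|[|[|[|i]]]]] //; case: j => [|[|[|[|[|j]]]]].
have := hv _ _ (m i) (m j); rewrite adj_compl.
have -> : v (i.*2 %% 5) != v (j.*2 %% 5).
  by apply: contra nij => /eqP /(induces_inj tc hv) E; apply/eqP/E.
rewrite !(induces_in tc hv) //= => E; apply: negb_inj; rewrite E; move: nij i5 j5.
by case: i {E} => [|[|[|[|[|i]]]]] //; case: j => [|[|[|[|[|j]]]]].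
Qed.

Lemma isomorphic_compl (U W : finType) (G : graph U) (H : graph W) :
  isomorphic G H -> isomorphic (compl_graph G) (compl_graph H).
Proof.
case=> f [fb fA]; exists f; split=> // x y.
rewrite !adj_compl (valP x) (valP y) (valP (f x)) (valP (f y)) fA.
by rewrite !(inj_eq val_inj) (bij_eq fb).
Qed.

(** The induction is on the number of vertices and covers all ambient types at once, because the
    pieces of a graph on [U] live on [U + bool]. *)
Lemma free_obtained (U : finType) (G : graph U) : free (adj G) -> obtained G.
Proof.
have [n] := ubnP #|vertices G|; elim: n U G => // n IH U G Gn fG.
have IHlt (W : finType) (H : graph W) : #|vertices H| < #|vertices G| -> free (adj H) -> obtained H.
  by move=> HG; apply: IH; apply: leq_trans HG _; rewrite -ltnS.
have [[X hX]|pG] := homogeneous_or_prime G.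
  have [G1 [G2 [G' [u [sub iso [f1 f2] l1 l2]]]]] := homogeneous_substitution fG hX.
  by apply: obtained_iso iso; apply: obtained_substitution sub; apply: IHlt.
have [c5|nC5] := induces_dec G pent_rel.
  by apply: obtained_pentagon; apply: prime_pentagon.
have unif : divided (vertices G) (adj G) -> obtained G.
  move=> /(divided_unification fG) [G1 [G2 [G' [un iso [f1 f2] l1 l2]]]].
  by apply: obtained_iso iso; apply: obtained_unification un; apply: IHlt.
have fG' := free_compl fG.
have counif : divided (vertices (compl_graph G)) (adj (compl_graph G)) -> obtained G.
  move=> /(divided_unification fG') [G1 [G2 [G' [un iso [f1 f2] l1 l2]]]].
  apply: (@obtained_iso _ _ (compl_graph G')).
    by apply: (@obtained_counification _ G1 G2); rewrite ?compl_graphK //; apply: IHlt.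
  by have := isomorphic_compl iso; rewrite compl_graphK.
have [/(divided_of_2K2 fG nC5 pG)[/unif|/counif]//|nK2] := has_2K2_dec G.
have nC5' : ~ induces pent_rel (adj (compl_graph G)) by move/induces_pent_compl.
(* The hypotheses are invariant under complementation, so an induced C4 is handled as a 2K2 of the
   complement, with the two kinds of unification exchanged. *)
have [/(divided_of_2K2 fG' nC5' (prime_compl pG))|nC4] := has_2K2_dec (compl_graph G).
  by rewrite compl_graphK => -[/counif|/unif].
exact/obtained_split/split_of_no_2K2_C4_C5.
Qed.

Unset Implicit Arguments.

Theorem mainTheorem2 (U : finType) (G : graph U) :
  is_free [:: P5; compl_graph P5] G <-> obtained G.
Proof.
split=> [/is_freeP|/obtained_free fG]; first exact: free_obtained.
by apply/is_freeP.
Qed.
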